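(* Let $\gamma$ satisfy $$1<\gamma<\frac{\sqrt7+1}{\sqrt7-1}\simeq 2.215,$$ and let the state $(\rho_-,u_-,e_-)$ be fixed. Then there exists a positive constant $\delta$ (depending on $(\rho_-,u_-,e_-)$ and $\gamma$) such that, for every state $(\rho_+,u_+,e_+)$ verifying: (i) $\|(\rho_+,u_+,e_+)-(\rho_-,u_-,e_-)\|\le\delta$, (ii) the step function equal to $(\rho_-,u_-,e_-)$ for $x<\sigma t$ and to $(\rho_+,u_+,e_+)$ for $x>\sigma t$ is a shock wave, with speed $\sigma$, for the standard Euler equations, there exists a $C^2$ traveling wave $(\rho,u,e)(x-\sigma t)$ that is a solution of the radiating gas system $$\begin{cases}\partial_t\rho+\partial_x(\rho u)=0,\\ \partial_t(\rho u)+\partial_x(\rho u^2+P)=0,\\ \partial_t(\rho E)+\partial_x(\rho E u+Pu+q)=0,\end{cases}\qquad q(t,x)=\frac12\int_{\mathbb{R}}e^{-|x-y|}\,\mathrm{sgn}(x-y)\,\theta(t,y)^4\,dy,$$ and satisfies $\lim_{\xi\to\pm\infty}(\rho,u,e)(\xi)=(\rho_\pm,u_\pm,e_\pm)$.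
   Context: Space is one-dimensional. The gas has density $\rho>0$, velocity $u\in\mathbb{R}$, specific internal energy $e$ and specific total energy $E=e+u^2/2$. The pressure $P$ and temperature $\theta$ are given by the perfect gas law $P=R\rho\theta=(\gamma-1)\rho e$, so $\theta=(\gamma-1)e/R$, where $R>0$ is a fixed constant (the perfect gas constant) and $\gamma>1$ is the ratio of specific heats. The states satisfy $\rho_\pm>0$, $e_\pm>0$. The function $\mathrm{sgn}$ equals $1$ on $(0,\infty)$, $0$ at $0$, $-1$ on $(-\infty,0)$. The standard Euler equations are the system displayed in the claim with $q\equiv0$. A shock wave with speed $\sigma$ for the Euler equations is a step function as in (ii) that satisfies the Rankine–Hugoniot conditions: with $v_\pm=u_\pm-\sigma$, $$\rho_+v_+=\rho_-v_-,\quad \rho_+v_+^2+P_+=\rho_-v_-^2+P_-,\quad \rho_+v_+\Big(e_++\tfrac{v_+^2}{2}\Big)+P_+v_+=\rho_-v_-\Big(e_-+\tfrac{v_-^2}{2}\Big)+P_-v_-,$$ and that satisfies the Lax shock inequalities, i.e. with the sound speed $c_\pm=\sqrt{\gamma(\gamma-1)e_\pm}$, it is either a 1-shock ($u_+-c_+<\sigma<u_+$ and $\sigma<u_--c_-$) or a 3-shock ($u_-<\sigma<u_-+c_-$ and $u_++c_+<\sigma$). A $C^2$ traveling wave is a triple of $C^2$ functions $(\rho,u,e)$ of the single variable $\xi=x-\sigma t\in\mathbb{R}$; then $\theta$ and $q$ are also functions of $\xi$ only. *)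

(* Defs.v *)
(* Stdlib reals with Coquelicot. *)
From Stdlib Require Import Reals.
From Coquelicot Require Import Coquelicot.
Open Scope R_scope.

(* A state of the gas is the triple (rho, u, e); the library norm on R * R * R
   is the Euclidean one. *)
Definition state : Type := (R * R * R)%type.

Definition density (U : state) : R := fst (fst U).
Definition velocity (U : state) : R := snd (fst U).
Definition energy (U : state) : R := snd U.

Definition admissible (U : state) : Prop := 0 < density U /\ 0 < energy U.

Definition pressure (gamma rho e : R) : R := (gamma - 1) * rho * e.
Definition temperature (Rgas gamma e : R) : R := (gamma - 1) * e / Rgas.
Definition total_energy (u e : R) : R := e + u ^ 2 / 2.
Definition sound_speed (gamma e : R) : R := sqrt (gamma * (gamma - 1) * e).

Definition rankine_hugoniot (gamma : R) (Um Up : state) (sigma : R) : Prop :=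
  let rm := density Um in let em := energy Um in
  let rp := density Up in let ep := energy Up in
  let vm := velocity Um - sigma in let vp := velocity Up - sigma in
  let Pm := pressure gamma rm em in let Pp := pressure gamma rp ep in
  rp * vp = rm * vm /\
  rp * vp ^ 2 + Pp = rm * vm ^ 2 + Pm /\
  rp * vp * (ep + vp ^ 2 / 2) + Pp * vp = rm * vm * (em + vm ^ 2 / 2) + Pm * vm.

Definition lax_1_shock (gamma : R) (Um Up : state) (sigma : R) : Prop :=
  velocity Up - sound_speed gamma (energy Up) < sigma < velocity Up /\
  sigma < velocity Um - sound_speed gamma (energy Um).

Definition lax_3_shock (gamma : R) (Um Up : state) (sigma : R) : Prop :=
  velocity Um < sigma < velocity Um + sound_speed gamma (energy Um) /\
  velocity Up + sound_speed gamma (energy Up) < sigma.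

(* The step function equal to Um for x < sigma t and to Up for x > sigma t is
   a shock wave of the Euler equations. *)
Definition euler_shock (gamma : R) (Um Up : state) (sigma : R) : Prop :=
  rankine_hugoniot gamma Um Up sigma /\
  (lax_1_shock gamma Um Up sigma \/ lax_3_shock gamma Um Up sigma).

(* Fields of the variables (t, x) take their arguments in that order;
   [sign] is the library's three-valued sign, with [sign 0 = 0]. *)
Definition flux_integrand (theta : R -> R -> R) (t x y : R) : R :=
  exp (- Rabs (x - y)) * sign (x - y) * theta t y ^ 4.

(* [RInt_gen] is total: the value is meaningful only where the integral
   converges, which [radiating_gas_solution] requires separately. *)
Definition radiative_flux (theta : R -> R -> R) (t x : R) : R :=
  / 2 * RInt_gen (flux_integrand theta t x)
          (Rbar_locally m_infty) (Rbar_locally p_infty).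

(* d_t A + d_x F = 0 in the classical sense, at every (t, x). *)
Definition conservation_law (A F : R -> R -> R) : Prop :=
  forall t x : R, exists a b : R,
    is_derive (fun s => A s x) t a /\ is_derive (fun y => F t y) x b /\ a + b = 0.

Definition radiating_gas_solution (Rgas gamma : R) (rho u e : R -> R -> R) : Prop :=
  let P := fun t x => pressure gamma (rho t x) (e t x) in
  let E := fun t x => total_energy (u t x) (e t x) in
  let theta := fun t x => temperature Rgas gamma (e t x) in
  let q := radiative_flux theta in
  (forall t x : R, 0 < rho t x /\ 0 < e t x) /\
  (forall t x : R, ex_RInt_gen (flux_integrand theta t x)
                     (Rbar_locally m_infty) (Rbar_locally p_infty)) /\
  conservation_law rho (fun t x => rho t x * u t x) /\
  conservation_law (fun t x => rho t x * u t x)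
                   (fun t x => rho t x * u t x ^ 2 + P t x) /\
  conservation_law (fun t x => rho t x * E t x)
                   (fun t x => rho t x * E t x * u t x + P t x * u t x + q t x).

Definition C2 (f : R -> R) : Prop :=
  forall x : R,
    ex_derive f x /\ ex_derive (Derive f) x /\ continuous (Derive (Derive f)) x.

(* Main.v *)
Require Import Defs.
From Stdlib Require Import Reals.
From Coquelicot Require Import Coquelicot.
From Stdlib Require Import Lra Lia.
Open Scope R_scope.

(** Why weak shocks have smooth radiative profiles.

    By reflection it suffices to treat 1-shocks. In the moving frame, with
    [v = u - sigma], the mass and momentum fluxes are constant, so [rho] and [e]
    are functions of [v], and the energy balance reads
    [q = A * (s ^ 2 - 1)] with [v = m * (1 - delta * s)], where [m] is the mean of
    the two end velocities, which is exactly the sonic velocity, and [s] runs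
    from -1 to 1. The definition of [q] as an integral is equivalent, for bounded
    functions, to [q' = theta ^ 4 - phi] and [phi' = - q]
    ([radiative_flux_integral]). Near the sonic velocity the temperature is a
    strictly decreasing function of [v]; call [H s] the emission [theta ^ 4]. The
    problem is now the planar system
    [phi' = A * (1 - s ^ 2)], [2 * A * s * s' = H s - phi],
    which is singular where [s = 0].

    For weak shocks the slope of [H] is of order [delta] and [A] of order
    [delta ^ 2], so that the system is a singular perturbation of
    [H'(s) * s' = A * (1 - s ^ 2)], solved by a hyperbolic tangent. Look therefore
    for [s = tanh Z] with [Z' = omega / B], where [omega] is the small ratio of [A]
    to the slope of [H] at 0. As a function of [y = sinh Z], the slowness [B] solves
    a first order equation [y * B' = g y B] in which [g] has a derivative in [B] of
    order [omega ^ (-2)]. Such an equation has exactly one solution on each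
    half-line that remains near 1, obtained as the fixed point of a contraction
    ([fuchs_half_line]). As the expansion rate exceeds 2, both of these solutions
    follow the same formal expansion at [y = 0] up to [O(y ^ 2)], so that they form
    a single C1 function ([fuchs_regular_solution]), and [s] is of class C2 across
    the singular point ([scalar_profile]). *)

(** * A contraction principle for functions *)

(** Banach's fixed point theorem for functions on [D] with the sup distance.
    The space [S] has bounded diameter, so iterating the contraction directly on
    that bound shows that any two iterates of rank at least [n] differ by at most
    [B * k ^ n]. *)
Lemma uniform_contraction_fixpoint (D : R -> Prop) (S : (R -> R) -> Prop)
  (Phi : (R -> R) -> R -> R) (k B : R) (q0 : R -> R) :
  0 <= k < 1 -> S q0 -> (forall q, S q -> S (Phi q)) ->
  (forall q p, S q -> S p -> forall y, D y -> Rabs (q y - p y) <= B) ->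
  (forall q p b, S q -> S p -> (forall y, D y -> Rabs (q y - p y) <= b) ->
     forall y, D y -> Rabs (Phi q y - Phi p y) <= k * b) ->
  (forall (f : nat -> R -> R) q, (forall n, S (f n)) ->
     (forall eps : posreal, exists n, forall y, D y -> Rabs (f n y - q y) <= eps) ->
     (forall y, D y -> is_lim_seq (fun n => f n y) (q y)) ->
     S q) ->
  exists q, S q /\ forall y, D y -> Phi q y = q y.
Proof.
  intros Hk H0 HS Hdiam Hcontr Hclosed.
  set (f := fun n => Nat.iter n Phi q0).
  assert (HSf : forall n, S (f n)).
  { intros n; induction n as [|n IH]; [exact H0 | exact (HS _ IH)]. }
  assert (Hpow : is_lim_seq (fun n => B * k ^ n) 0).
  { replace (Finite 0) with (Rbar_mult (Finite B) (Finite 0)) by (simpl; f_equal; ring).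
    apply is_lim_seq_scal_l, is_lim_seq_geom. rewrite Rabs_pos_eq; lra. }
  assert (Hcau : forall n p y, D y -> Rabs (f (n + p)%nat y - f n y) <= B * k ^ n).
  { intros n; induction n as [|n IH]; intros p y Hy.
    - simpl. rewrite Rmult_1_r. apply (Hdiam (f p) q0); auto.
    - replace (B * k ^ Datatypes.S n) with (k * (B * k ^ n)) by (simpl; ring).
      apply (Hcontr (f (n + p)%nat) (f n)); auto. }
  set (q := fun y => real (Lim_seq (fun n => f n y))).
  assert (Hlim : forall y, D y -> is_lim_seq (fun n => f n y) (q y)).
  { intros y Hy. apply Lim_seq_correct'.
    apply ex_lim_seq_cauchy_corr. intros eps.
    apply is_lim_seq_spec in Hpow. destruct (Hpow (pos_div_2 eps)) as [N HN].
    exists N. intros n p Hn Hp. specialize (HN N (le_n N)). simpl in HN.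
    rewrite Rminus_0_r in HN. apply Rabs_lt_between in HN.
    pose proof (Hcau N (n - N)%nat y Hy) as H1. pose proof (Hcau N (p - N)%nat y Hy) as H2.
    replace (N + (n - N))%nat with n in H1 by lia.
    replace (N + (p - N))%nat with p in H2 by lia.
    apply Rabs_le_between in H1. apply Rabs_le_between in H2.
    apply Rabs_lt_between. lra. }
  assert (Hunif : forall n y, D y -> Rabs (f n y - q y) <= B * k ^ n).
  { intros n y Hy.
    assert (HL : is_lim_seq (fun p => Rabs (f n y - f (p + n)%nat y)) (Rabs (f n y - q y))).
    { apply (is_lim_seq_abs _ (Finite _)). apply is_lim_seq_minus'; [apply is_lim_seq_const|].
      apply (is_lim_seq_incr_n (fun p => f p y) n). auto. }
    assert (Hle : forall p, Rabs (f n y - f (p + n)%nat y) <= B * k ^ n).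
    { intros p. rewrite Rabs_minus_sym, Nat.add_comm. exact (Hcau n p y Hy). }
    exact (is_lim_seq_le _ _ _ (B * k ^ n) Hle HL (is_lim_seq_const _)). }
  exists q.
  assert (HSq : S q).
  { apply (Hclosed f); auto. intros eps.
    apply is_lim_seq_spec in Hpow. destruct (Hpow eps) as [N HN].
    exists N. intros y Hy. specialize (HN N (le_n N)). rewrite Rminus_0_r in HN.
    apply Rabs_lt_between in HN. specialize (Hunif N y Hy). lra. }
  split; auto. intros y Hy.
  apply Rminus_diag_uniq. apply Rabs_eq_0. apply Rle_antisym; [|apply Rabs_pos].
  assert (HL : is_lim_seq (fun n => 2 * (B * k ^ n)) 0).
  { replace (Finite 0) with (Rbar_mult (Finite 2) (Finite 0)) by (simpl; f_equal; ring).
    apply is_lim_seq_scal_l, Hpow. }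
  apply (is_lim_seq_le (fun _ => Rabs (Phi q y - q y)) (fun n => 2 * (B * k ^ n))
    (Rabs (Phi q y - q y)) 0); auto using is_lim_seq_const.
  intros n.
  assert (H1 := Hcontr q (f n) (B * k ^ n) HSq (HSf n)).
  assert (H2 : forall y, D y -> Rabs (q y - f n y) <= B * k ^ n).
  { intros t Ht. rewrite Rabs_minus_sym. auto. }
  specialize (H1 H2 y Hy). assert (H3 := Hunif (Datatypes.S n) y Hy).
  change (f (Datatypes.S n) y) with (Phi (f n) y) in H3.
  simpl in H3.
  assert (Hb : 0 <= B * k ^ n) by (eapply Rle_trans; [apply Rabs_pos | apply (H2 y Hy)]).
  replace (B * (k * k ^ n)) with (k * (B * k ^ n)) in H3 by ring.
  assert (Hkb : k * (B * k ^ n) <= B * k ^ n) by nra.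
  apply Rabs_le_between in H1. apply Rabs_le_between in H3.
  apply Rabs_le_between. lra.
Qed.

(** * Averages that invert the operator n - y d/dy *)

(** With [n = k + 3] this is [int_1^oo t^(-n-1) f (y t) dt] after [t = 1 / (b y)]:
    the only solution of [n u - y u' = f] that stays bounded when [f] is. Taking
    the reciprocal [b] of the argument of [f] as variable turns the improper
    integral into a proper one. The offset 3 makes [b ^ (k + 2) * f (/ b)]
    integrable at 0 even for quadratic [f]. *)
Definition avg (k : nat) (f : R -> R) (y : R) : R :=
  y ^ (k + 3) * RInt (fun b => b ^ (k + 2) * f (/ b)) 0 (/ y).

Definition averageable (k : nat) (f : R -> R) : Prop :=
  forall a, 0 < a -> ex_RInt (fun b => b ^ (k + 2) * f (/ b)) 0 a.

Lemma continuous_pow (n : nat) (x : R) : continuous (fun b : R => b ^ n) x.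
Proof.
  apply (ex_derive_continuous (V := R_NormedModule)). auto_derive. auto.
Qed.

Lemma averageable_bounded (k : nat) (f : R -> R) (C : R) :
  (forall y, 0 < y -> continuous f y) -> (forall y, 0 < y -> Rabs (f y) <= C) ->
  averageable k f.
Proof.
  intros Hf HC a Ha.
  (* the integrand is extended by 0 to negative arguments, where f is arbitrary *)
  apply (ex_RInt_ext (fun b => b ^ (k + 1) * (Rmax b 0 * f (/ b)))).
  { intros b. rewrite Rmin_left, Rmax_right by lra. intros Hb.
    rewrite Rmax_left by lra. rewrite <- Rmult_assoc. f_equal.
    replace (k + 2)%nat with (S (k + 1)) by lia. simpl; ring. }
  apply (@ex_RInt_continuous R_CompleteNormedModule). intros z.
  rewrite Rmin_left, Rmax_right by lra. intros Hz.
  apply (continuous_mult (K := R_AbsRing)); [apply continuous_pow|].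
  destruct (Req_dec z 0) as [->|Hz0].
  - apply filterlim_locally. intros eps. rewrite Rmax_left, Rmult_0_l by lra.
    assert (HC0 : 0 <= C) by (eapply Rle_trans; [apply Rabs_pos | apply (HC 1); lra]).
    assert (Hd : 0 < eps / (C + 1)) by (apply Rdiv_lt_0_compat; [apply cond_pos | lra]).
    exists (mkposreal _ Hd). intros b Hb.
    change (Rabs (b - 0) < eps / (C + 1)) in Hb. rewrite Rminus_0_r in Hb.
    change (Rabs (Rmax b 0 * f (/ b) - 0) < eps). rewrite Rminus_0_r.
    destruct (Rle_lt_dec b 0) as [Hb0|Hb0].
    + rewrite Rmax_right, Rmult_0_l, Rabs_R0 by lra. apply cond_pos.
    + rewrite Rmax_left by lra. rewrite Rabs_mult.
      apply Rle_lt_trans with (Rabs b * C).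
      { apply Rmult_le_compat_l; [apply Rabs_pos|]. apply HC, Rinv_0_lt_compat, Hb0. }
      apply Rle_lt_trans with (eps / (C + 1) * C).
      { apply Rmult_le_compat_r; lra. }
      apply (Rmult_lt_reg_r (C + 1)); [lra|].
      pose proof (cond_pos eps). field_simplify; [|lra]. nra.
  - apply (continuous_ext_loc _ (fun b => b * f (/ b))).
    + exists (mkposreal z ltac:(lra)). intros b Hb.
      change (Rabs (b - z) < z) in Hb. apply Rabs_lt_between in Hb.
      rewrite Rmax_left; lra.
    + apply (continuous_mult (K := R_AbsRing)); [apply continuous_id|].
      apply continuous_comp; [apply continuous_Rinv; lra|].
      apply Hf, Rinv_0_lt_compat. lra.
Qed.

Lemma is_RInt_pow (n : nat) (a : R) : is_RInt (fun b => b ^ n) 0 a (a ^ S n / INR (S n)).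
Proof.
  replace (a ^ S n / INR (S n)) with (minus (a ^ S n / INR (S n)) (0 ^ S n / INR (S n))).
  2:{ unfold minus, plus, opp; simpl. unfold Rdiv. ring. }
  apply (is_RInt_derive (fun b => b ^ S n / INR (S n))).
  - intros x _. pose proof (lt_0_INR (S n) (Nat.lt_0_succ n)).
    auto_derive; auto. change (match n with O => 1 | S _ => INR n + 1 end) with (INR (S n)).
    simpl pred. field. lra.
  - intros x _. apply continuous_pow.
Qed.

Lemma is_RInt_avg_quadratic (k : nat) (c0 c1 c2 a : R) : 0 < a ->
  is_RInt (fun b => b ^ (k + 2) * (c0 + c1 * / b + c2 * (/ b) ^ 2)) 0 a
    (a ^ (k + 3) * (c0 / (INR k + 3) + c1 * / a / (INR k + 2) + c2 * (/ a) ^ 2 / (INR k + 1))).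
Proof.
  intros Ha.
  apply (is_RInt_ext (fun b => plus (plus (scal c0 (b ^ (k + 2))) (scal c1 (b ^ (k + 1))))
                                   (scal c2 (b ^ k)))).
  { intros b. rewrite Rmin_left, Rmax_right by lra. intros Hb.
    unfold plus, scal; simpl. unfold mult; simpl. rewrite !pow_add. simpl. field. lra. }
  pose proof (pos_INR k).
  replace (a ^ (k + 3) * _) with
    (plus (plus (scal c0 (a ^ S (k + 2) / INR (S (k + 2))))
                (scal c1 (a ^ S (k + 1) / INR (S (k + 1)))))
          (scal c2 (a ^ S k / INR (S k)))).
  { apply (is_RInt_plus (V := R_NormedModule));
      [apply (is_RInt_plus (V := R_NormedModule))|];
      apply (is_RInt_scal (V := R_NormedModule)); apply is_RInt_pow. }
  unfold plus, scal; cbn -[pow INR]. unfold mult; cbn -[pow INR].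
  rewrite !S_INR, !plus_INR. simpl (INR 2). simpl (INR 1).
  change (a ^ S (k + 2)) with (a * a ^ (k + 2)). change (a ^ S (k + 1)) with (a * a ^ (k + 1)).
  change (a ^ S k) with (a * a ^ k).
  rewrite !pow_add. simpl. field. lra.
Qed.

Lemma averageable_quadratic (k : nat) (c0 c1 c2 : R) :
  averageable k (fun y => c0 + c1 * y + c2 * y ^ 2).
Proof. intros a Ha. eexists. apply is_RInt_avg_quadratic, Ha. Qed.

(** Monomials are eigenfunctions of the average, so bounds by [c y ^ i] with
    [i <= 2] are carried over with a factor [1 / (n - i)]. *)
Lemma avg_quadratic (k : nat) (c0 c1 c2 y : R) : 0 < y ->
  avg k (fun y => c0 + c1 * y + c2 * y ^ 2) y =
  c0 / (INR k + 3) + c1 * y / (INR k + 2) + c2 * y ^ 2 / (INR k + 1).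
Proof.
  intros Hy. unfold avg.
  rewrite (is_RInt_unique _ _ _ _ (is_RInt_avg_quadratic k c0 c1 c2 _ (Rinv_0_lt_compat _ Hy))).
  rewrite Rinv_inv, <- Rmult_assoc, <- Rpow_mult_distr, Rinv_r, pow1 by lra. ring.
Qed.

Lemma avg_le (k : nat) (f g : R -> R) (y : R) : 0 < y ->
  averageable k f -> averageable k g -> (forall t, 0 < t -> f t <= g t) ->
  avg k f y <= avg k g y.
Proof.
  intros Hy Hf Hg Hfg. unfold avg. pose proof (Rinv_0_lt_compat _ Hy).
  apply Rmult_le_compat_l; [apply pow_le; lra|].
  apply RInt_le; auto; [lra|]. intros b Hb.
  apply Rmult_le_compat_l; [apply pow_le; lra|]. apply Hfg, Rinv_0_lt_compat. lra.
Qed.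

Lemma avg_minus (k : nat) (f g : R -> R) (y : R) : 0 < y ->
  averageable k f -> averageable k g ->
  averageable k (fun t => f t - g t) /\ avg k (fun t => f t - g t) y = avg k f y - avg k g y.
Proof.
  intros Hy Hf Hg.
  assert (H : forall a, 0 < a -> is_RInt (fun b => b ^ (k + 2) * (f (/ b) - g (/ b))) 0 a
     (RInt (fun b => b ^ (k + 2) * f (/ b)) 0 a - RInt (fun b => b ^ (k + 2) * g (/ b)) 0 a)).
  { intros a Ha.
    apply (is_RInt_ext (fun b => minus (b ^ (k + 2) * f (/ b)) (b ^ (k + 2) * g (/ b)))).
    { intros b _. unfold minus, plus, opp; simpl. ring. }
    apply (is_RInt_minus (V := R_NormedModule)); apply (RInt_correct (V := R_CompleteNormedModule)); auto. }
  split.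
  - intros a Ha. eexists. apply H, Ha.
  - unfold avg. rewrite (is_RInt_unique _ _ _ _ (H _ (Rinv_0_lt_compat _ Hy))). ring.
Qed.

Lemma is_derive_avg (k : nat) (f : R -> R) (y : R) : 0 < y ->
  averageable k f -> (forall t, 0 < t -> continuous f t) ->
  is_derive (avg k f) y (((INR k + 3) * avg k f y - f y) / y).
Proof.
  intros Hy Hf Hc. pose proof (Rinv_0_lt_compat _ Hy) as Hiy.
  set (F := fun a => RInt (fun b => b ^ (k + 2) * f (/ b)) 0 a).
  assert (HF : is_derive F (/ y) ((/ y) ^ (k + 2) * f y)).
  { assert (E : (/ y) ^ (k + 2) * f y = (fun b => b ^ (k + 2) * f (/ b)) (/ y)).
    { simpl. rewrite Rinv_inv. reflexivity. }
    rewrite E. apply (is_derive_RInt (fun b => b ^ (k + 2) * f (/ b)) F 0 (/ y)).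
    - exists (mkposreal _ Hiy). intros a Ha.
      change (Rabs (a - / y) < / y) in Ha. apply Rabs_lt_between in Ha.
      apply (RInt_correct (V := R_CompleteNormedModule)), Hf. lra.
    - apply (continuous_mult (K := R_AbsRing)); [apply continuous_pow|].
      apply (continuous_comp Rinv f (/ y)); [apply continuous_Rinv; lra|].
      rewrite Rinv_inv. auto. }
  unfold avg. fold F.
  assert (H1 : is_derive (fun y => F (/ y)) y (- / y ^ 2 * ((/ y) ^ (k + 2) * f y))).
  { apply (is_derive_comp F (fun y => / y)); [exact HF|].
    auto_derive; [lra|]. field. lra. }
  evar_last.
  { apply (is_derive_mult (fun y => y ^ (k + 3)) (fun y => F (/ y)) y
       (INR (k + 3) * y ^ (k + 2))); [|exact H1| intros; apply Rmult_comm].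
    auto_derive; auto. replace (Init.Nat.pred (k + 3)) with (k + 2)%nat by lia. ring. }
  change (RInt (fun b : R => b ^ (k + 2) * f (/ b)) 0 (/ y)) with (F (/ y)).
  unfold plus, mult; simpl. rewrite plus_INR. rewrite !pow_add, pow_inv.
  pose proof (pow_lt y k Hy). simpl. field. lra.
Qed.

(** * Singular first order equations with an expanding field *)

(** The right-hand side of a singular equation [y q' = g y q] whose solutions are
    pushed out of the strip between [alpha] and [beta] as [y] moves away from 0.
    [Q0 + Q1 * y] is the jet at [y = 0] of a formal smooth solution. *)
Record expanding_field (n mu alpha beta Q0 Q1 K : R) (g : R -> R -> R) : Prop := {
  ef_continuous : forall q y, continuous q y -> continuous (fun t => g t (q t)) y;
  ef_lower : forall y, g y alpha <= 0;
  ef_upper : forall y, 0 <= g y beta;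
  ef_slope : forall y P Q, alpha <= P -> P <= Q -> Q <= beta ->
    mu * (Q - P) <= g y Q - g y P <= n * (Q - P);
  ef_range : forall t, -1 <= t <= 1 -> alpha <= Q0 + Q1 * t <= beta;
  ef_jet : forall y, -1 <= y <= 1 -> Rabs (g y (Q0 + Q1 * y) - Q1 * y) <= K * y ^ 2 }.

(** Since [g] grows with slope at least [mu] in [q], only one solution remains in
    the strip for all [y > 0]. It is the fixed point of [q -> avg (n q - g q)]:
    [n] dominates the slope of [g], so [n q - g y q] is increasing and
    [(n - mu)]-Lipschitz in [q], and the average divides by [n]. The same
    computation with weight [y ^ 2], for which the average divides by [n - 2],
    preserves the distance [C * y ^ 2] to the jet exactly because [mu > 2]; this
    is what makes the two half-line solutions fit together differentiably. *)
Lemma fuchs_half_line (k : nat) (mu alpha beta Q0 Q1 K : R) (g : R -> R -> R) :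
  2 < mu <= INR k + 3 -> 0 <= K -> expanding_field (INR k + 3) mu alpha beta Q0 Q1 K g ->
  exists (q : R -> R) (C : R), forall y, 0 < y ->
    alpha <= q y <= beta /\ is_derive q y (g y (q y) / y) /\
    Rabs (q y - Q0 - Q1 * y) <= C * y ^ 2 /\
    Rabs (g y (q y) - Q1 * y) <= C * y ^ 2.
Proof.
  intros Hmu HK [Hcont Hlo Hhi Hslope Hrange Hjet].
  pose proof (pos_INR k) as Hk. set (n := INR k + 3) in *.
  assert (Hn3 : 3 <= n) by (unfold n; lra).
  assert (Hn2 : INR k + 2 = n - 1) by (unfold n; ring).
  assert (Hn1 : INR k + 1 = n - 2) by (unfold n; ring).
  pose proof (Hrange 0 ltac:(lra)) as HQ0. pose proof (Hrange 1 ltac:(lra)) as HQp.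
  pose proof (Hrange (-1) ltac:(lra)) as HQm.
  assert (HQ1 : Rabs Q1 <= beta - alpha) by (apply Rabs_le; lra).
  pose proof (Rabs_pos Q1) as HQ1'.
  assert (Hab : alpha <= beta) by lra.
  (* the first term serves the jet for y <= 1, the second is the crude bound for y > 1 *)
  set (C := K / (mu - 2) + 6 * (beta - alpha)).
  assert (HKC : 0 <= K / (mu - 2)) by (apply Rdiv_le_0_compat; lra).
  assert (HC1 : 6 * (beta - alpha) <= C) by (unfold C; lra).
  assert (HC2 : K <= (mu - 2) * C).
  { unfold C. replace ((mu - 2) * _) with (K + (mu - 2) * (6 * (beta - alpha))) by (field; lra).
    nra. }
  assert (HCpos : 0 <= C) by lra.
  set (M := fun (q : R -> R) y => n * q y - g y (q y)).
  set (S := fun q : R -> R => forall y, 0 < y ->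
    continuous q y /\ alpha <= q y <= beta /\ Rabs (q y - Q0 - Q1 * y) <= C * y ^ 2).
  assert (HMdiff : forall y P Q b, alpha <= P <= beta -> alpha <= Q <= beta ->
    Rabs (Q - P) <= b -> Rabs ((n * Q - g y Q) - (n * P - g y P)) <= (n - mu) * b).
  { assert (HH : forall y P Q b, alpha <= P <= beta -> alpha <= Q <= beta -> P <= Q ->
      Rabs (Q - P) <= b -> Rabs ((n * Q - g y Q) - (n * P - g y P)) <= (n - mu) * b).
    { intros y P Q b HP HQ HPQ Hb. rewrite Rabs_pos_eq in Hb by lra.
      pose proof (Hslope y P Q ltac:(lra) HPQ ltac:(lra)) as H.
      rewrite Rabs_pos_eq by lra. nra. }
    intros y P Q b HP HQ Hb. destruct (Rle_dec P Q); [auto|].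
    rewrite Rabs_minus_sym. apply HH; try lra. rewrite Rabs_minus_sym. auto. }
  assert (HMc : forall q, S q -> forall y, 0 < y -> continuous (M q) y).
  { intros q Hq y Hy. destruct (Hq y Hy) as [Hc _].
    apply (continuous_minus (V := R_NormedModule) (fun t => n * q t)); auto.
    apply (continuous_mult (K := R_AbsRing) (fun _ => n)); auto using continuous_const. }
  assert (HMb : forall q, S q -> forall y, 0 < y -> n * alpha <= M q y <= n * beta).
  { intros q Hq y Hy. destruct (Hq y Hy) as [_ [Hb _]].
    pose proof (Hslope y alpha (q y) ltac:(lra) ltac:(lra) ltac:(lra)).
    pose proof (Hslope y (q y) beta ltac:(lra) ltac:(lra) ltac:(lra)).
    pose proof (Hlo y). pose proof (Hhi y). unfold M. lra. }
  assert (HMa : forall q, S q -> averageable k (M q)).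
  { intros q Hq. apply averageable_bounded with (Rmax (Rabs (n * alpha)) (Rabs (n * beta))).
    - apply HMc, Hq.
    - intros y Hy. apply RmaxAbs; apply HMb; auto. }
  assert (HMj : forall q, S q -> forall y, 0 < y ->
    Rabs (M q y - (n * Q0 + (n - 1) * Q1 * y)) <= (n - 2) * C * y ^ 2).
  { intros q Hq y Hy. destruct (Hq y Hy) as [_ [Hb Hj]].
    pose proof (HMb q Hq y Hy) as HM.
    destruct (Rle_lt_dec y 1) as [Hy1|Hy1].
    - pose proof (Hrange y ltac:(lra)) as Hr. pose proof (Hjet y ltac:(lra)) as HJ.
      pose proof (HMdiff y (Q0 + Q1 * y) (q y) (C * y ^ 2) Hr Hb) as HD.
      replace (q y - (Q0 + Q1 * y)) with (q y - Q0 - Q1 * y) in HD by ring.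
      specialize (HD Hj).
      apply Rabs_le_between in HD. apply Rabs_le_between in HJ.
      pose proof (pow2_ge_0 y). apply Rabs_le. unfold M. nra.
    - apply Rabs_le_between in HQ1. apply Rabs_le.
      assert (1 <= y ^ 2) by nra. assert (y <= y ^ 2) by nra.
      assert (E1 : Rabs (M q y - n * Q0) <= n * (beta - alpha) * y ^ 2).
      { apply Rabs_le. split; nra. }
      assert (E2 : Rabs ((n - 1) * Q1 * y) <= n * (beta - alpha) * y ^ 2).
      { rewrite !Rabs_mult, (Rabs_pos_eq (n - 1)), (Rabs_pos_eq y) by lra.
        apply Rmult_le_compat; try nra.
        apply Rmult_le_compat; try lra. apply Rabs_le; lra. }
      assert (E3 : 2 * (n * (beta - alpha)) <= (n - 2) * C) by nra.
      apply Rabs_le_between in E1. apply Rabs_le_between in E2.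
      assert (E4 : 2 * (n * (beta - alpha)) * y ^ 2 <= (n - 2) * C * y ^ 2) by nra.
      lra. }
  set (Phi := fun q => avg k (M q)).
  assert (HPd : forall q, S q -> forall y, 0 < y ->
    is_derive (Phi q) y ((n * Phi q y - M q y) / y)).
  { intros q Hq y Hy. apply is_derive_avg; auto. }
  assert (HPS : forall q, S q -> S (Phi q)).
  { intros q Hq y Hy. split; [|split].
    - apply (ex_derive_continuous (V := R_NormedModule)). eexists. apply HPd; auto.
    - split.
      + replace alpha with (avg k (fun y => n * alpha + 0 * y + 0 * y ^ 2) y).
        { apply avg_le; auto using averageable_quadratic.
          intros t Ht. pose proof (HMb q Hq t Ht). lra. }
        rewrite avg_quadratic by auto. fold n. field; lra.
      + replace beta with (avg k (fun y => n * beta + 0 * y + 0 * y ^ 2) y).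
        { apply avg_le; auto using averageable_quadratic.
          intros t Ht. pose proof (HMb q Hq t Ht). lra. }
        rewrite avg_quadratic by auto. fold n. field; lra.
    - assert (U : Phi q y <= Q0 + Q1 * y + C * y ^ 2).
      { replace (Q0 + Q1 * y + C * y ^ 2) with
          (avg k (fun y => n * Q0 + (n - 1) * Q1 * y + (n - 2) * C * y ^ 2) y).
        { apply avg_le; auto using averageable_quadratic.
          intros t Ht. pose proof (HMj q Hq t Ht) as HJ. apply Rabs_le_between in HJ. lra. }
        rewrite avg_quadratic by auto. fold n. rewrite Hn1, Hn2. field; lra. }
      assert (L : Q0 + Q1 * y + - C * y ^ 2 <= Phi q y).
      { replace (Q0 + Q1 * y + - C * y ^ 2) with
          (avg k (fun y => n * Q0 + (n - 1) * Q1 * y + (n - 2) * - C * y ^ 2) y).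
        { apply avg_le; auto using averageable_quadratic.
          intros t Ht. pose proof (HMj q Hq t Ht) as HJ. apply Rabs_le_between in HJ. lra. }
        rewrite avg_quadratic by auto. fold n. rewrite Hn1, Hn2. field; lra. }
      apply Rabs_le. lra. }
  destruct (uniform_contraction_fixpoint (fun y => 0 < y) S Phi ((n - mu) / n) (beta - alpha)
    (fun y => Q0 + Q1 * (y / (1 + y)))) as [q [Hq Hfix]].
  - split; [apply Rdiv_le_0_compat; lra|].
    apply (Rmult_lt_reg_r n); [lra|]. field_simplify; lra.
  - (* an initial function with the right jet at 0 and values in the strip *)
    intros y Hy.
    assert (Hy1 : 0 < y / (1 + y) <= 1).
    { split; [apply Rdiv_lt_0_compat; lra|].
      apply (Rmult_le_reg_r (1 + y)); [lra|]. field_simplify; lra. }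
    split; [|split].
    + apply (ex_derive_continuous (V := R_NormedModule)). auto_derive. lra.
    + apply Hrange. lra.
    + replace (Q0 + Q1 * (y / (1 + y)) - Q0 - Q1 * y)
        with (- (Q1 * (y / (1 + y)) * y)) by (field; lra).
      rewrite Rabs_Ropp, !Rabs_mult, (Rabs_pos_eq (y / (1 + y))), (Rabs_pos_eq y) by lra.
      assert (y / (1 + y) <= y).
      { apply (Rmult_le_reg_r (1 + y)); [lra|]. field_simplify; nra. }
      replace (y ^ 2) with (y * y) by ring.
      rewrite <- Rmult_assoc. apply Rmult_le_compat_r; [lra|].
      apply Rmult_le_compat; lra.
  - exact HPS.
  - intros q p Hq Hp y Hy. destruct (Hq y Hy) as [_ [? _]]. destruct (Hp y Hy) as [_ [? _]].
    apply Rabs_le. lra.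
  - intros q p b Hq Hp Hb y Hy.
    destruct (avg_minus k (M q) (M p) y Hy (HMa q Hq) (HMa p Hp)) as [Ha E].
    unfold Phi. rewrite <- E.
    assert (HM : forall t, 0 < t -> Rabs (M q t - M p t) <= (n - mu) * b).
    { intros t Ht. apply HMdiff; [apply (Hp t Ht)|apply (Hq t Ht)|auto]. }
    apply Rabs_le. split.
    + replace (- _) with (avg k (fun y => - ((n - mu) * b) + 0 * y + 0 * y ^ 2) y).
      { apply avg_le; auto using averageable_quadratic.
        intros t Ht. specialize (HM t Ht). apply Rabs_le_between in HM. lra. }
      rewrite avg_quadratic by auto. fold n. field; lra.
    + replace (_ / n * b) with (avg k (fun y => (n - mu) * b + 0 * y + 0 * y ^ 2) y).
      { apply avg_le; auto using averageable_quadratic.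
        intros t Ht. specialize (HM t Ht). apply Rabs_le_between in HM. lra. }
      rewrite avg_quadratic by auto. fold n. field; lra.
  - intros f q Hf Hunif Hlim y Hy. split; [|split].
    + apply filterlim_locally. intros eps.
      destruct (Hunif (mkposreal (eps / 4) ltac:(pose proof (cond_pos eps); lra))) as [N HN].
      simpl in HN. destruct (Hf N y Hy) as [Hc _].
      apply filterlim_locally with (eps := pos_div_2 eps) in Hc.
      assert (Hp : locally y (fun t => 0 < t)) by (apply open_gt, Hy).
      generalize (filter_and _ _ Hc Hp). apply filter_imp. intros t [H1 H2].
      change (Rabs (f N t - f N y) < eps / 2) in H1.
      change (Rabs (q t - q y) < eps).
      pose proof (HN t H2) as H3. pose proof (HN y Hy) as H4.
      apply Rabs_lt_between in H1. apply Rabs_le_between in H3. apply Rabs_le_between in H4.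
      pose proof (cond_pos eps). apply Rabs_lt_between. lra.
    + split.
      * apply (is_lim_seq_le (fun _ => alpha) (fun n => f n y) alpha (q y));
          auto using is_lim_seq_const. intros m. apply (Hf m y Hy).
      * apply (is_lim_seq_le (fun n => f n y) (fun _ => beta) (q y) beta);
          auto using is_lim_seq_const. intros m. apply (Hf m y Hy).
    + apply (is_lim_seq_le (fun n => Rabs (f n y - Q0 - Q1 * y)) (fun _ => C * y ^ 2)
        (Rabs (q y - Q0 - Q1 * y)) (C * y ^ 2)); auto using is_lim_seq_const.
      * intros m. apply (Hf m y Hy).
      * apply (is_lim_seq_abs _ (Finite _)).
        apply is_lim_seq_minus'; [apply is_lim_seq_minus'|]; auto using is_lim_seq_const.
  - exists q, ((2 * n - 2) * C). intros y Hy. destruct (Hq y Hy) as [_ [Hb Hj]].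
    assert (Hj2 : Rabs (g y (q y) - Q1 * y) <= (2 * n - 2) * C * y ^ 2).
    { pose proof (HMj q Hq y Hy) as HJ. unfold M in HJ.
      apply Rabs_le_between in HJ. apply Rabs_le_between in Hj. apply Rabs_le. split; nra. }
    split; [auto|split; [|split; [|auto]]].
    + apply (is_derive_ext_loc (Phi q)).
      { assert (Hp : locally y (fun t => 0 < t)) by (apply open_gt, Hy).
        revert Hp. apply filter_imp. intros t Ht. auto. }
      replace (g y (q y)) with (n * Phi q y - M q y); [apply HPd; auto|].
      rewrite Hfix by auto. unfold M. ring.
    + eapply Rle_trans; [exact Hj|]. pose proof (pow2_ge_0 y).
      apply Rmult_le_compat_r; nra.
Qed.

Lemma expanding_field_reflect (n mu alpha beta Q0 Q1 K : R) (g : R -> R -> R) :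
  expanding_field n mu alpha beta Q0 Q1 K g ->
  expanding_field n mu alpha beta Q0 (- Q1) K (fun y => g (- y)).
Proof.
  intros [Hc Hl Hh Hs Hr Hj]. split; auto.
  - intros q y Hq.
    apply (continuous_ext (fun t => g (- t) (q (- - t)))).
    { intros t. rewrite Ropp_involutive. reflexivity. }
    apply (continuous_comp Ropp (fun t => g t (q (- t)))).
    { apply (continuous_opp (V := R_NormedModule) (fun t => t)), continuous_id. }
    apply (Hc (fun t => q (- t))).
    apply (continuous_comp Ropp q).
    + apply (continuous_opp (V := R_NormedModule) (fun t => t)), continuous_id.
    + rewrite Ropp_involutive. exact Hq.
  - intros t Ht. replace (Q0 + - Q1 * t) with (Q0 + Q1 * - t) by ring. apply Hr. lra.
  - intros y Hy. replace (- Q1 * y) with (Q1 * - y) by ring.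
    replace (y ^ 2) with ((- y) ^ 2) by ring. apply Hj. lra.
Qed.

(** The solutions on both sides of the singular point share the jet
    [Q0 + Q1 * y] up to [O(y ^ 2)]; the equation itself then gives
    [q' y = g y (q y) / y = Q1 + O(y)], so the glued function is continuously
    differentiable at 0. *)
Lemma fuchs_regular_solution (k : nat) (mu alpha beta Q0 Q1 K : R) (g : R -> R -> R) :
  2 < mu <= INR k + 3 -> 0 <= K -> expanding_field (INR k + 3) mu alpha beta Q0 Q1 K g ->
  exists q q' : R -> R, forall y,
    alpha <= q y <= beta /\ is_derive q y (q' y) /\ continuous q' y /\ y * q' y = g y (q y).
Proof.
  intros Hmu HK Hg.
  destruct (fuchs_half_line k mu alpha beta Q0 Q1 K g Hmu HK Hg) as [qp [Cp Hp]].
  destruct (fuchs_half_line k mu alpha beta Q0 (- Q1) K _ Hmu HK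
    (expanding_field_reflect _ _ _ _ _ _ _ _ Hg)) as [qm [Cm Hm]].
  destruct Hg as [Hc Hl Hu Hs Hr Hj].
  set (q := fun y => if Rlt_dec 0 y then qp y else if Rlt_dec y 0 then qm (- y) else Q0).
  assert (Ep : forall y, 0 < y -> q y = qp y).
  { intros y Hy. unfold q. destruct (Rlt_dec 0 y); [auto|lra]. }
  assert (Em : forall y, y < 0 -> q y = qm (- y)).
  { intros y Hy. unfold q. destruct (Rlt_dec 0 y); [lra|]. destruct (Rlt_dec y 0); [auto|lra]. }
  assert (E0 : q 0 = Q0).
  { unfold q. destruct (Rlt_dec 0 0); [lra|]. destruct (Rlt_dec 0 0); lra. }
  set (C := Rmax 0 (Rmax Cp Cm)).
  assert (HC : 0 <= C /\ Cp <= C /\ Cm <= C).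
  { unfold C. pose proof (Rmax_l 0 (Rmax Cp Cm)). pose proof (Rmax_r 0 (Rmax Cp Cm)).
    pose proof (Rmax_l Cp Cm). pose proof (Rmax_r Cp Cm). lra. }
  assert (Hoff : forall y, y <> 0 -> alpha <= q y <= beta /\
    is_derive q y (g y (q y) / y) /\
    Rabs (q y - Q0 - Q1 * y) <= C * y ^ 2 /\ Rabs (g y (q y) - Q1 * y) <= C * y ^ 2).
  { intros y Hy. pose proof (pow2_ge_0 y) as Hy2. destruct (Rlt_dec 0 y) as [H|H].
    - destruct (Hp y H) as [H1 [H2 [H3 H4]]]. rewrite Ep by auto.
      split; [auto|split; [|split; nra]].
      apply (is_derive_ext_loc qp); auto.
      apply (filter_imp (fun t => 0 < t)); [|apply open_gt, H].
      intros t Ht. rewrite Ep; auto.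
    - assert (Hn : 0 < - y) by lra.
      destruct (Hm (- y) Hn) as [H1 [H2 [H3 H4]]]. rewrite Em by lra.
      rewrite Ropp_involutive in H2, H4.
      replace (- Q1 * - y) with (Q1 * y) in H3, H4 by ring.
      replace ((- y) ^ 2) with (y ^ 2) in H3, H4 by ring.
      split; [auto|split; [|split; nra]].
      apply (is_derive_ext_loc (fun t => qm (- t))).
      + apply (filter_imp (fun t => t < 0)); [|apply open_lt; lra].
        intros t Ht. rewrite Em; auto.
      + evar_last.
        { apply (is_derive_comp qm Ropp); [exact H2|]. auto_derive; [auto|reflexivity]. }
        unfold scal; simpl; unfold mult; simpl. field. lra. }
  set (q' := fun y => if Req_EM_T y 0 then Q1 else g y (q y) / y).
  assert (F0 : q' 0 = Q1) by (unfold q'; destruct (Req_EM_T 0 0); [auto|lra]).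
  assert (F1 : forall y, y <> 0 -> q' y = g y (q y) / y).
  { intros y Hy. unfold q'. destruct (Req_EM_T y 0); [lra|auto]. }
  assert (Hder : forall y, is_derive q y (q' y)).
  { intros y. destruct (Req_dec y 0) as [->|Hy].
    - rewrite F0. apply is_derive_Reals. intros eps Heps.
      assert (Hd : 0 < eps / (C + 1)) by (apply Rdiv_lt_0_compat; lra).
      exists (mkposreal _ Hd). intros h Hh0 Hh. simpl in Hh. rewrite Rplus_0_l, E0.
      destruct (Hoff h Hh0) as [_ [_ [H3 _]]].
      replace ((q h - Q0) / h - Q1) with ((q h - Q0 - Q1 * h) / h) by (field; auto).
      unfold Rdiv. rewrite Rabs_mult, Rabs_inv.
      pose proof (Rabs_pos_lt h Hh0) as Hpos.
      apply Rle_lt_trans with (C * Rabs h).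
      + apply (Rmult_le_reg_r (Rabs h)); auto. rewrite Rmult_assoc, Rinv_l by lra.
        rewrite <- pow2_abs in H3. lra.
      + apply (Rmult_lt_compat_r (C + 1)) in Hh; [|lra].
        replace (eps / (C + 1) * (C + 1)) with eps in Hh by (field; lra). nra.
    - rewrite F1 by auto. apply Hoff, Hy. }
  exists q, q'. intros y. split; [|split; [auto|split]].
  - destruct (Req_dec y 0) as [->|Hy]; [|apply Hoff, Hy].
    rewrite E0. pose proof (Hr 0 ltac:(lra)). lra.
  - destruct (Req_dec y 0) as [->|Hy].
    + apply filterlim_locally. intros eps. rewrite F0.
      assert (Hd : 0 < eps / (C + 1)) by (apply Rdiv_lt_0_compat; [apply cond_pos | lra]).
      exists (mkposreal _ Hd). intros h Hh.
      change (Rabs (h - 0) < eps / (C + 1)) in Hh. rewrite Rminus_0_r in Hh.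
      change (Rabs (q' h - Q1) < eps).
      destruct (Req_dec h 0) as [->|Hh0].
      { rewrite F0, Rminus_diag, Rabs_R0. apply cond_pos. }
      rewrite F1 by auto. destruct (Hoff h Hh0) as [_ [_ [_ H4]]].
      replace (g h (q h) / h - Q1) with ((g h (q h) - Q1 * h) / h) by (field; auto).
      unfold Rdiv. rewrite Rabs_mult, Rabs_inv.
      pose proof (Rabs_pos_lt h Hh0) as Hpos.
      apply Rle_lt_trans with (C * Rabs h).
      * apply (Rmult_le_reg_r (Rabs h)); auto. rewrite Rmult_assoc, Rinv_l by lra.
        rewrite <- pow2_abs in H4. lra.
      * apply (Rmult_lt_compat_r (C + 1)) in Hh; [|lra]. pose proof (cond_pos eps).
        replace (eps / (C + 1) * (C + 1)) with (pos eps) in Hh by (field; lra). nra.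
    + apply (continuous_ext_loc _ (fun t => g t (q t) / t)).
      * apply (filter_imp (fun t => t <> 0)); [intros t Ht; symmetry; apply F1, Ht|].
        apply open_neq, Hy.
      * apply (continuous_mult (K := R_AbsRing)); [|apply continuous_Rinv, Hy].
        apply Hc. apply (ex_derive_continuous (V := R_NormedModule)). eexists. apply Hder.
  - destruct (Req_dec y 0) as [->|Hy].
    + rewrite Rmult_0_l, E0. pose proof (Hj 0 ltac:(lra)) as H.
      replace (Q0 + Q1 * 0) with Q0 in H by ring.
      replace (K * 0 ^ 2) with 0 in H by ring. rewrite Rmult_0_r, Rminus_0_r in H.
      pose proof (Rabs_pos (g 0 Q0)). symmetry. apply Rabs_eq_0. lra.
    + rewrite F1 by auto. field. auto.
Qed.

(** * Autonomous equations and the hyperbolic tangent *)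

(** Separation of variables: [Z] is the inverse of the primitive of [/ f]. *)
Lemma autonomous_flow (f : R -> R) (a b : R) :
  0 < a -> (forall z, continuous f z) -> (forall z, a <= f z <= b) ->
  exists Z : R -> R, (forall x, is_derive Z x (f (Z x))) /\
    is_lim Z m_infty m_infty /\ is_lim Z p_infty p_infty.
Proof.
  intros Ha Hc Hf. assert (Hb : 0 < b) by (specialize (Hf 0); lra).
  set (T := fun z => RInt (fun r => / f r) 0 z).
  assert (Hci : forall z, continuous (fun r => / f r) z).
  { intros z. apply (continuous_comp f Rinv); auto.
    apply continuous_Rinv. specialize (Hf z). lra. }
  assert (HT : forall z, is_derive T z (/ f z)).
  { intros z. apply (is_derive_RInt (fun r => / f r) T 0 z); auto.
    apply filter_forall. intros t. apply (RInt_correct (V := R_CompleteNormedModule)).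
    apply (@ex_RInt_continuous R_CompleteNormedModule). auto. }
  assert (HTc : continuity T).
  { intros z. apply derivable_continuous_pt. exists (/ f z). apply is_derive_Reals, HT. }
  assert (HMV : forall u v, exists c, Rmin u v <= c <= Rmax u v /\ v - u = f c * (T v - T u)).
  { intros u v. destruct (MVT_gen T u v (fun z => / f z)) as [c [Hcc E]]; auto.
    exists c. split; [auto|]. rewrite E. specialize (Hf c). field. lra. }
  assert (HT0 : T 0 = 0) by (unfold T; apply (RInt_point (V := R_CompleteNormedModule))).
  assert (Hsurj : forall x, {z | T z = x}).
  { intros x.
    destruct (IVT_gen T (- (b * Rabs x)) (b * Rabs x) x HTc) as [z [_ Hz]]; [|exists z; auto].
    pose proof (Rabs_pos x) as Hx0.
    assert (H1 : Rabs x <= T (b * Rabs x)).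
    { destruct (HMV 0 (b * Rabs x)) as [c [_ E]]. rewrite HT0 in E. specialize (Hf c).
      apply Rnot_lt_le. intros H. nra. }
    assert (H2 : T (- (b * Rabs x)) <= - Rabs x).
    { destruct (HMV 0 (- (b * Rabs x))) as [c [_ E]]. rewrite HT0 in E. specialize (Hf c).
      apply Rnot_lt_le. intros H. nra. }
    pose proof (Rle_abs x). pose proof (Rle_abs (- x)) as H3. rewrite Rabs_Ropp in H3.
    split; [eapply Rle_trans; [apply Rmin_l|lra] | eapply Rle_trans; [|apply Rmax_r]; lra]. }
  set (Z := fun x => proj1_sig (Hsurj x)).
  assert (HZ : forall x, T (Z x) = x) by (intros x; exact (proj2_sig (Hsurj x))).
  assert (HMZ : forall x y, exists c, Rabs (c - Z x) <= b * Rabs (y - x) /\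
    Z y - Z x = f c * (y - x)).
  { intros x y. destruct (HMV (Z x) (Z y)) as [c [Hcc E]]. rewrite !HZ in E.
    exists c. split; [|auto].
    assert (H1 : Rabs (c - Z x) <= Rabs (Z y - Z x)).
    { destruct (Rle_dec (Z x) (Z y)).
      - rewrite Rmin_left, Rmax_right in Hcc by lra. rewrite !Rabs_pos_eq; lra.
      - rewrite Rmin_right, Rmax_left in Hcc by lra. rewrite !Rabs_left1; lra. }
    eapply Rle_trans; [exact H1|]. rewrite E, Rabs_mult. specialize (Hf c).
    rewrite (Rabs_pos_eq (f c)) by lra. apply Rmult_le_compat_r; [apply Rabs_pos|lra]. }
  exists Z. split; [|split].
  - intros x. apply is_derive_Reals. intros eps Heps.
    specialize (Hc (Z x)). apply filterlim_locally with (eps := mkposreal eps Heps) in Hc.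
    destruct Hc as [d Hd].
    assert (Hdb : 0 < d / b) by (apply Rdiv_lt_0_compat; [apply cond_pos|lra]).
    exists (mkposreal _ Hdb). intros h Hh0 Hh. simpl in Hh.
    destruct (HMZ x (x + h)) as [c [H1 H2]].
    rewrite H2. replace (x + h - x) with h in * by ring.
    replace (f c * h / h) with (f c) by (field; auto).
    apply (Hd c). change (Rabs (c - Z x) < d).
    eapply Rle_lt_trans; [exact H1|].
    apply (Rmult_lt_compat_l b) in Hh; [|lra].
    replace (b * (d / b)) with (pos d) in Hh by (field; lra). exact Hh.
  - apply is_lim_spec. intros M. exists (Rmin 0 ((M - Z 0) / a)). intros x Hx.
    destruct (HMZ 0 x) as [c [_ H2]]. specialize (Hf c).
    pose proof (Rmin_l 0 ((M - Z 0) / a)). pose proof (Rmin_r 0 ((M - Z 0) / a)) as H3.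
    assert (H4 : x < (M - Z 0) / a) by lra.
    apply (Rmult_lt_compat_l a) in H4; [|lra].
    replace (a * ((M - Z 0) / a)) with (M - Z 0) in H4 by (field; lra).
    rewrite Rminus_0_r in H2. nra.
  - apply is_lim_spec. intros M. exists (Rmax 0 ((M - Z 0) / a)). intros x Hx.
    destruct (HMZ 0 x) as [c [_ H2]]. specialize (Hf c).
    pose proof (Rmax_l 0 ((M - Z 0) / a)). pose proof (Rmax_r 0 ((M - Z 0) / a)) as H3.
    assert (H4 : (M - Z 0) / a < x) by lra.
    apply (Rmult_lt_compat_l a) in H4; [|lra].
    replace (a * ((M - Z 0) / a)) with (M - Z 0) in H4 by (field; lra).
    rewrite Rminus_0_r in H2. nra.
Qed.

Lemma is_lim_tanh_p : is_lim tanh p_infty 1.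
Proof.
  apply (is_lim_ext (fun z => 1 - 2 * / (exp (2 * z) + 1))).
  { intros z. unfold tanh, sinh, cosh.
    replace (2 * z) with (z + z) by ring. rewrite exp_plus, exp_Ropp.
    pose proof (exp_pos z). field. split; nra. }
  assert (H : is_lim (fun z => exp (2 * z) + 1) p_infty p_infty).
  { apply is_lim_spec. intros M. exists (Rabs M). intros x Hx.
    pose proof (exp_ineq1_le (2 * x)). pose proof (Rle_abs M). pose proof (Rabs_pos M). lra. }
  apply is_lim_inv in H; [|discriminate]. simpl in H.
  replace (Finite 1) with (Finite (1 - 2 * 0)) by (f_equal; ring).
  apply (is_lim_minus' _ _ _ 1 (2 * 0)); [apply is_lim_const|].
  apply (is_lim_scal_l _ 2 p_infty 0), H.
Qed.

Lemma is_lim_tanh_m : is_lim tanh m_infty (-1).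
Proof.
  apply (is_lim_ext (fun z => - tanh (- z))).
  { intros z. unfold tanh, sinh, cosh. rewrite Ropp_involutive.
    pose proof (exp_pos z). pose proof (exp_pos (- z)). field. lra. }
  apply (is_lim_opp _ _ 1).
  apply (is_lim_comp tanh Ropp m_infty 1 p_infty is_lim_tanh_p).
  - apply (is_lim_opp (fun x => x) m_infty m_infty), is_lim_id.
  - exists 0. intros y _. discriminate.
Qed.

Lemma is_derive_tanh (z : R) : is_derive tanh z (1 - tanh z ^ 2).
Proof.
  unfold tanh, sinh, cosh. pose proof (exp_pos z). pose proof (exp_pos (- z)).
  auto_derive; [lra|]. field. lra.
Qed.

Lemma tanh_range (z : R) : -1 < tanh z < 1.
Proof.
  unfold tanh, sinh, cosh. pose proof (exp_pos z). pose proof (exp_pos (- z)).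
  split; apply (Rmult_lt_reg_r ((exp z + exp (- z)) / 2)); try lra; field_simplify; lra.
Qed.

(** * The equation of the slowness *)

(** [f x = 1 + c x + O(x ^ 2)] with a uniform constant for [|x| <= 1]. *)
Definition unit_jet (c : R) (f : R -> R) : Prop :=
  exists K, 0 <= K /\ forall x, -1 <= x <= 1 -> Rabs (f x - 1 - c * x) <= K * x ^ 2.

Lemma unit_jet_mult (c d : R) (f g : R -> R) :
  unit_jet c f -> unit_jet d g -> unit_jet (c + d) (fun x => f x * g x).
Proof.
  intros [K [HK Hf]] [L [HL Hg]].
  pose proof (Rabs_pos c). pose proof (Rabs_pos d).
  exists (K * (1 + Rabs d + L) + L * (1 + Rabs c) + Rabs c * Rabs d).
  split; [nra|]. intros x Hx. specialize (Hf x Hx). specialize (Hg x Hx).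
  replace (f x * g x - 1 - (c + d) * x) with
    ((f x - 1 - c * x) * (1 + d * x + (g x - 1 - d * x)) + (g x - 1 - d * x) * (1 + c * x)
      + c * d * x ^ 2) by ring.
  assert (Hx1 : Rabs x <= 1) by (apply Rabs_le; lra).
  assert (Hx2 : 0 <= x ^ 2 <= 1) by nra.
  assert (Hlin : forall u, Rabs (1 + u * x) <= 1 + Rabs u).
  { intros u. eapply Rle_trans; [apply Rabs_triang|]. rewrite Rabs_R1, Rabs_mult.
    pose proof (Rabs_pos u). pose proof (Rabs_pos x). nra. }
  assert (H1 : Rabs (1 + d * x + (g x - 1 - d * x)) <= 1 + Rabs d + L).
  { eapply Rle_trans; [apply Rabs_triang|]. specialize (Hlin d). nra. }
  eapply Rle_trans; [apply Rabs_triang|].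
  eapply Rle_trans; [apply Rplus_le_compat_r, Rabs_triang|].
  rewrite !Rabs_mult, (Rabs_pos_eq (x ^ 2)) by lra.
  specialize (Hlin c).
  assert (H2 : Rabs (f x - 1 - c * x) * Rabs (1 + d * x + (g x - 1 - d * x))
     <= K * x ^ 2 * (1 + Rabs d + L)) by (apply Rmult_le_compat; auto using Rabs_pos).
  assert (H3 : Rabs (g x - 1 - d * x) * Rabs (1 + c * x) <= L * x ^ 2 * (1 + Rabs c))
    by (apply Rmult_le_compat; auto using Rabs_pos).
  nra.
Qed.

Lemma unit_jet_affine (c : R) : unit_jet c (fun x => 1 + c * x).
Proof.
  exists 0. split; [lra|]. intros x _.
  replace (1 + c * x - 1 - c * x) with 0 by ring. rewrite Rabs_R0. lra.
Qed.

(** Right-hand side of the equation for the slowness of the profile, divided by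
    the small parameter [e]: for [e] small it expands strongly around [Q = h]. *)
Definition relaxation_field (e : R) (h c : R -> R) (y Q : R) : R :=
  Q ^ 2 * (Q - h y) / e + c y * Q.

(** Around [Q = h = 1] the derivative of [Q ^ 2 * (Q - h) / e] is close to [1 / e],
    which dwarfs the rest. [Q0] is the root near 1 of [Q (1 - Q) = e] and [Q1]
    cancels the linear term, so the jet solves the equation up to [O(y ^ 2)]. *)
Lemma relaxation_expanding (e h1 K n : R) (h c : R -> R) :
  0 < e <= / 100 -> 2 / e <= n -> 0 <= K -> Rabs h1 <= / 20 ->
  (forall y, continuous h y) -> (forall y, continuous c y) ->
  (forall y, Rabs (h y - 1) <= / 20) -> (forall y, -2 <= c y <= 1) ->
  (forall y, Rabs (h y - 1 - h1 * y) <= K * y ^ 2) ->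
  (forall y, Rabs (c y - 1) <= K * y ^ 2) ->
  exists Q0 Q1 L, 0 <= L /\
    expanding_field n 3 (9 / 10) (11 / 10) Q0 Q1 L (relaxation_field e h c).
Proof.
  intros He Hn HK Hh1 Hhc Hcc Hh Hc Hhj Hcj.
  assert (Hroot : exists Q0, 98 / 100 <= Q0 <= 1 /\ Q0 * (1 - Q0) = e).
  { assert (Hs : sqrt (1 - 4 * e) * sqrt (1 - 4 * e) = 1 - 4 * e) by (apply sqrt_sqrt; lra).
    pose proof (sqrt_pos (1 - 4 * e)).
    exists ((1 + sqrt (1 - 4 * e)) / 2). split; [split; nra|nra]. }
  destruct Hroot as [Q0 [HQ0 HQe]].
  assert (HQ1 : exists Q1, Rabs Q1 <= 3 / 50 /\ (3 * Q0 - 2) * Q1 = Q0 * h1).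
  { exists (Q0 * h1 / (3 * Q0 - 2)). split; [|field; lra].
    apply Rabs_le_between in Hh1. apply Rabs_le.
    assert (E : (3 * Q0 - 2) * (Q0 * h1 / (3 * Q0 - 2)) = Q0 * h1) by (field; lra).
    set (t := Q0 * h1 / (3 * Q0 - 2)) in *. split; nra. }
  destruct HQ1 as [Q1 [HQ1 HQ1e]].
  assert (He' : 0 < / e) by (apply Rinv_0_lt_compat; lra).
  assert (Hee : e * / e = 1) by (apply Rinv_r; lra).
  assert (Hie : 100 <= / e) by nra.
  apply Rabs_le_between in HQ1. apply Rabs_le_between in Hh1.
  exists Q0, Q1, ((1 + 2 * K) / e + 2 * K).
  split; [unfold Rdiv; nra|]. unfold relaxation_field. split.
  - intros q y Hq.
    apply (continuous_plus (V := R_NormedModule)).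
    + apply (continuous_mult (K := R_AbsRing)); [|apply continuous_const].
      apply (continuous_mult (K := R_AbsRing)).
      * apply (continuous_comp q (fun t => t ^ 2)); [auto|apply continuous_pow].
      * apply (continuous_minus (V := R_NormedModule)); auto.
    + apply (continuous_mult (K := R_AbsRing)); auto.
  - intros y. specialize (Hh y). specialize (Hc y). apply Rabs_le_between in Hh.
    unfold Rdiv. nra.
  - intros y. specialize (Hh y). specialize (Hc y). apply Rabs_le_between in Hh.
    unfold Rdiv. nra.
  - intros y P Q HP HPQ HQ. specialize (Hh y). specialize (Hc y). apply Rabs_le_between in Hh.
    replace (Q ^ 2 * (Q - h y) / e + c y * Q - (P ^ 2 * (P - h y) / e + c y * P)) with
      (((Q ^ 2 + Q * P + P ^ 2 - h y * (Q + P)) * / e + c y) * (Q - P)) by (field; lra).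
    assert (HA : 1 / 2 <= Q ^ 2 + Q * P + P ^ 2 - h y * (Q + P) <= 195 / 100).
    { split; nra. }
    assert (HS : 3 <= (Q ^ 2 + Q * P + P ^ 2 - h y * (Q + P)) * / e + c y <= 2 / e).
    { unfold Rdiv. set (A := Q ^ 2 + Q * P + P ^ 2 - h y * (Q + P)) in *. split; nra. }
    split; apply Rmult_le_compat_r; lra.
  - intros t Ht. split; nra.
  - intros y Hy. set (Q := Q0 + Q1 * y).
    assert (HQ : 9 / 10 <= Q <= 11 / 10) by (unfold Q; split; nra).
    replace (Q ^ 2 * (Q - h y) / e + c y * Q - Q1 * y) with
      ((Q1 ^ 2 * (Q0 - 1) + 2 * Q0 * Q1 * (Q1 - h1) + y * Q1 ^ 2 * (Q1 - h1)) * y ^ 2 * / e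
       + (- Q ^ 2 * / e * (h y - 1 - h1 * y) + Q * (c y - 1))
       + ((Q0 ^ 2 * (Q0 - 1) * / e + Q0)
          + y * Q0 * ((3 * Q0 - 2) * Q1 - Q0 * h1) * / e)) by (unfold Q; field; lra).
    rewrite HQ1e, Rminus_diag, Rmult_0_r, Rmult_0_l, Rplus_0_r.
    replace (Q0 ^ 2 * (Q0 - 1) * / e + Q0) with (Q0 * (1 - Q0 * (1 - Q0) * / e)) by ring.
    rewrite HQe, Hee, Rminus_diag, Rmult_0_r, Rplus_0_r.
    specialize (Hhj y). specialize (Hcj y).
    assert (Hy2 : 0 <= y ^ 2) by apply pow2_ge_0.
    assert (B1 : Rabs (Q1 ^ 2 * (Q0 - 1) + 2 * Q0 * Q1 * (Q1 - h1) + y * Q1 ^ 2 * (Q1 - h1)) <= 1).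
    { assert (0 <= Q1 ^ 2 <= 1 / 100) by nra.
      assert (Rabs (Q1 ^ 2 * (Q0 - 1)) <= 1 / 10) by (apply Rabs_le; nra).
      assert (Rabs (Q1 - h1) <= 1 / 5) by (apply Rabs_le; lra).
      assert (Rabs (2 * Q0 * Q1 * (Q1 - h1)) <= 1 / 5 * 1).
      { rewrite Rmult_comm, Rabs_mult. apply Rmult_le_compat; auto using Rabs_pos.
        apply Rabs_le; nra. }
      assert (Rabs (y * Q1 ^ 2 * (Q1 - h1)) <= 1 / 5 * 1).
      { rewrite Rmult_comm, Rabs_mult. apply Rmult_le_compat; auto using Rabs_pos.
        apply Rabs_le; nra. }
      eapply Rle_trans; [apply Rabs_triang|].
      eapply Rle_trans; [apply Rplus_le_compat_r, Rabs_triang|]. lra. }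
    eapply Rle_trans; [apply Rabs_triang|].
    assert (B2 : Rabs (- Q ^ 2 * / e * (h y - 1 - h1 * y)) <= 2 * / e * (K * y ^ 2)).
    { rewrite Rabs_mult. apply Rmult_le_compat; auto using Rabs_pos.
      rewrite Rabs_mult, (Rabs_pos_eq (/ e)) by lra.
      apply Rmult_le_compat_r; [lra|]. apply Rabs_le. nra. }
    assert (B3 : Rabs (Q * (c y - 1)) <= 2 * (K * y ^ 2)).
    { rewrite Rabs_mult. apply Rmult_le_compat; auto using Rabs_pos. apply Rabs_le. lra. }
    pose proof (Rabs_triang (- Q ^ 2 * / e * (h y - 1 - h1 * y)) (Q * (c y - 1))) as B4.
    rewrite (Rabs_mult _ (/ e)), (Rabs_mult _ (y ^ 2)), (Rabs_pos_eq (y ^ 2)), (Rabs_pos_eq (/ e)) by lra.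
    set (W := Rabs (Q1 ^ 2 * (Q0 - 1) + _ + _)) in *.
    assert (B5 : W * y ^ 2 * / e <= 1 * y ^ 2 * / e).
    { apply Rmult_le_compat_r; [lra|]. apply Rmult_le_compat_r; lra. }
    unfold Rdiv. lra.
Qed.

(** For a shock with mean relative velocity [m] and relative amplitude [delta], the
    velocity [m (1 - x)] has the emission [theta ^ 4] proportional to [X ^ 4] with
    [X = (1 - x) (1 + gamma x)]; this is the derivative [4 X ^ 3 X'], divided by
    its value at [x = 0], so that it stays close to 1 along a weak shock. *)
Definition emission_slope (gamma x : R) : R :=
  (1 - x) * (1 + gamma * x) * ((1 - x) * (1 + gamma * x)) * ((1 - x) * (1 + gamma * x)) *
  (1 - 2 * gamma / (gamma - 1) * x).

Lemma emission_slope_jet (gamma : R) : exists c, unit_jet c (emission_slope gamma).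
Proof.
  assert (H1 : unit_jet (-1) (fun x => 1 - x)).
  { destruct (unit_jet_affine (-1)) as [K [HK H]]. exists K. split; auto.
    intros x Hx. replace (1 - x) with (1 + -1 * x) by ring. auto. }
  assert (H2 : unit_jet (- (2 * gamma / (gamma - 1))) (fun x => 1 - 2 * gamma / (gamma - 1) * x)).
  { destruct (unit_jet_affine (- (2 * gamma / (gamma - 1)))) as [K [HK H]]. exists K. split; auto.
    intros x Hx. replace (1 - 2 * gamma / (gamma - 1) * x)
      with (1 + - (2 * gamma / (gamma - 1)) * x) by ring. auto. }
  pose proof (unit_jet_mult _ _ _ _ H1 (unit_jet_affine gamma)) as H3.
  eexists. unfold emission_slope.
  apply unit_jet_mult; [|exact H2].
  apply unit_jet_mult; [|exact H3]. apply unit_jet_mult; exact H3.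
Qed.

Lemma is_derive_sinh (z : R) : is_derive sinh z (cosh z).
Proof. apply is_derive_Reals, derivable_pt_lim_sinh. Qed.

Lemma cosh_pos (z : R) : 0 < cosh z.
Proof. unfold cosh. pose proof (exp_pos z). pose proof (exp_pos (- z)). lra. Qed.

Lemma sqrt_1_sinh2 (z : R) : sqrt (1 + sinh z ^ 2) = cosh z.
Proof.
  replace (1 + sinh z ^ 2) with (cosh z * cosh z).
  - apply sqrt_square. pose proof (cosh_pos z). lra.
  - unfold cosh, sinh. rewrite exp_Ropp. pose proof (exp_pos z). field. lra.
Qed.

(** The state variable [s] runs through (-1, 1); [y = s / sqrt (1 - s ^ 2)]
    straightens the vector field [s (1 - s ^ 2) d/ds] into [y d/dy]. *)
Lemma sine_of_slope (y : R) : let s := y / sqrt (1 + y ^ 2) in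
  s ^ 2 <= y ^ 2 /\ s ^ 2 <= 1 /\ Rabs (s - y) <= y ^ 2 /\
  continuous (fun y => y / sqrt (1 + y ^ 2)) y.
Proof.
  intros s. pose proof (pow2_ge_0 y) as Hy.
  assert (Hr2 : sqrt (1 + y ^ 2) * sqrt (1 + y ^ 2) = 1 + y ^ 2) by (apply sqrt_sqrt; lra).
  assert (Hr : 1 <= sqrt (1 + y ^ 2)).
  { rewrite <- sqrt_1 at 1. apply sqrt_le_1; lra. }
  set (r := sqrt (1 + y ^ 2)) in *.
  assert (Hs : s * r = y) by (unfold s; field; lra).
  assert (Hs2 : s ^ 2 <= 1).
  { apply (Rmult_le_reg_r (r * r)); [nra|]. replace (s ^ 2 * (r * r)) with ((s * r) ^ 2) by ring.
    rewrite Hs. lra. }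
  assert (Hs3 : s ^ 2 <= y ^ 2).
  { rewrite <- Hs. replace ((s * r) ^ 2) with (s ^ 2 * (r * r)) by ring.
    pose proof (pow2_ge_0 s). nra. }
  split; [auto|split; [auto|split]].
  - (* |s - y| = |s| (r - 1) with r - 1 = y^2 / (r + 1) *)
    rewrite <- Hs at 1. replace (s - s * r) with (- (s * (r - 1))) by ring.
    rewrite Rabs_Ropp, Rabs_mult, (Rabs_pos_eq (r - 1)) by lra.
    assert (Rabs s <= 1) by (apply Rabs_le; nra).
    pose proof (Rabs_pos s). nra.
  - apply (ex_derive_continuous (V := R_NormedModule)). auto_derive.
    fold r. replace (y * (y * 1)) with (y ^ 2) by ring. fold r. repeat split; lra.
Qed.

(** The equation [e * y * Q' = Q ^ 2 * (Q - h) + e * (1 - 3 * s ^ 2) * Q] of the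
    slowness, solved in [y] and read in the variable [z] with [y = sinh z] and
    [s = tanh z], where [y d/dy] is [tanh z d/dz]. In this form the equation holds
    at the sonic point [z = 0] too. *)
Lemma profile_slowness (gamma : R) : exists delta0, 0 < delta0 /\
  forall delta e, 0 < delta <= delta0 -> 0 < e <= / 100 ->
  exists B B' : R -> R, forall z,
    9 / 10 <= B z <= 11 / 10 /\ is_derive B z (B' z) /\ continuous B' z /\
    e * (tanh z * B' z) = B z ^ 2 * (B z - emission_slope gamma (delta * tanh z))
                          + e * (1 - 3 * tanh z ^ 2) * B z.
Proof.
  destruct (emission_slope_jet gamma) as [c [K [HK Hjet]]].
  pose proof (Rabs_pos c) as Hc0.
  (* so that |c| x + K x^2 <= 1/20 for 0 <= x <= d0 *)
  set (d0 := / (20 * (Rabs c + K + 1))).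
  assert (Hd0 : 0 < d0) by (apply Rinv_0_lt_compat; lra).
  assert (Hd0e : d0 * (20 * (Rabs c + K + 1)) = 1) by (apply Rinv_l; lra).
  exists d0. split; [auto|]. intros d e Hd He.
  assert (Hd1 : d <= 1) by nra.
  assert (Hdc : d * (Rabs c + K + 1) <= / 20) by nra.
  set (sn := fun y => y / sqrt (1 + y ^ 2)).
  set (h := fun y => emission_slope gamma (d * sn y)).
  set (cc := fun y => 1 - 3 * sn y ^ 2).
  assert (Hsn : forall y, sn y ^ 2 <= y ^ 2 /\ sn y ^ 2 <= 1 /\ Rabs (sn y - y) <= y ^ 2 /\
    continuous sn y) by (intros y; apply (sine_of_slope y)).
  assert (Hds : forall y, -1 <= d * sn y <= 1).
  { intros y. destruct (Hsn y) as [_ [H _]]. split; nra. }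
  destruct (INR_unbounded (2 / e)) as [k Hk].
  destruct (relaxation_expanding e (c * d) (K + 3) (INR k + 3) h cc) as [Q0 [Q1 [L [HL HE]]]];
    auto; try lra.
  - rewrite Rabs_mult, (Rabs_pos_eq d) by lra. nra.
  - intros y. unfold h.
    apply (continuous_comp (fun y => d * sn y) (emission_slope gamma)).
    + apply (continuous_mult (K := R_AbsRing) (fun _ => d)); [apply continuous_const|apply Hsn].
    + apply (ex_derive_continuous (V := R_NormedModule)). unfold emission_slope.
      auto_derive. auto.
  - intros y. unfold cc.
    apply (continuous_comp sn (fun s => 1 - 3 * s ^ 2)); [apply Hsn|].
    apply (ex_derive_continuous (V := R_NormedModule)). auto_derive. auto.
  - intros y. unfold h. pose proof (Hjet _ (Hds y)) as HJ. destruct (Hsn y) as [_ [H _]].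
    assert (Hs1 : Rabs (sn y) <= 1) by (apply Rabs_le; nra).
    replace (emission_slope gamma (d * sn y) - 1) with
      ((emission_slope gamma (d * sn y) - 1 - c * (d * sn y)) + c * (d * sn y)) by ring.
    eapply Rle_trans; [apply Rabs_triang|].
    rewrite !Rabs_mult, (Rabs_pos_eq d) by lra.
    assert (Rabs c * (d * Rabs (sn y)) <= Rabs c * (d * 1)).
    { apply Rmult_le_compat_l; [auto|]. apply Rmult_le_compat_l; lra. }
    assert ((d * sn y) ^ 2 <= d) by nra.
    assert (K * (d * sn y) ^ 2 <= K * d) by (apply Rmult_le_compat_l; auto).
    lra.
  - intros y. unfold cc. destruct (Hsn y) as [_ [H _]]. pose proof (pow2_ge_0 (sn y)). lra.
  - intros y. unfold h. pose proof (Hjet _ (Hds y)) as HJ. destruct (Hsn y) as [H1 [H2 [H3 _]]].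
    replace (emission_slope gamma (d * sn y) - 1 - c * d * y) with
      ((emission_slope gamma (d * sn y) - 1 - c * (d * sn y)) + (c * d) * (sn y - y)) by ring.
    eapply Rle_trans; [apply Rabs_triang|].
    rewrite (Rabs_mult (c * d)), (Rabs_mult c), (Rabs_pos_eq d) by lra.
    assert (Rabs c * d <= 1) by nra.
    assert (Rabs c * d * Rabs (sn y - y) <= 1 * y ^ 2).
    { apply Rmult_le_compat; [apply Rmult_le_pos; lra|apply Rabs_pos|auto|auto]. }
    assert ((d * sn y) ^ 2 <= y ^ 2).
    { rewrite Rpow_mult_distr. pose proof (pow2_ge_0 (sn y)). assert (d ^ 2 <= 1) by nra. nra. }
    assert (K * (d * sn y) ^ 2 <= K * y ^ 2) by (apply Rmult_le_compat_l; auto).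
    pose proof (pow2_ge_0 y). lra.
  - intros y. unfold cc. destruct (Hsn y) as [H1 [H2 [H3 _]]].
    replace (1 - 3 * sn y ^ 2 - 1) with (- (3 * sn y ^ 2)) by ring.
    pose proof (pow2_ge_0 (sn y)). rewrite Rabs_Ropp, Rabs_pos_eq by lra. nra.
  - destruct (fuchs_regular_solution k 3 (9 / 10) (11 / 10) Q0 Q1 L _
      ltac:(split; [lra|]; pose proof (pos_INR k); lra) HL HE) as [q [q' Hq]].
    exists (fun z => q (sinh z)), (fun z => cosh z * q' (sinh z)). intros z.
    destruct (Hq (sinh z)) as [H1 [H2 [H3 H4]]].
    split; [auto|split; [|split]].
    + apply (is_derive_comp q sinh); [auto|apply is_derive_sinh].
    + apply (continuous_mult (K := R_AbsRing)).
      * apply (ex_derive_continuous (V := R_NormedModule)). unfold cosh. auto_derive. auto.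
      * apply (continuous_comp sinh q'); [|auto].
        apply (ex_derive_continuous (V := R_NormedModule)). eexists. apply is_derive_sinh.
    + pose proof (cosh_pos z).
      assert (Et : sn (sinh z) = tanh z) by (unfold sn; rewrite sqrt_1_sinh2; reflexivity).
      unfold relaxation_field, h, cc in H4. rewrite Et in H4.
      replace (tanh z * (cosh z * q' (sinh z))) with (sinh z * q' (sinh z))
        by (unfold tanh; field; lra).
      rewrite H4. field. lra.
Qed.

(** The equation between [s], [s1] and [s2] expresses [phi' = - q] for
    [phi = H s - 2 * A * s * s'], divided by the slope of [H] at 0. With
    [s = tanh Z] and [Z' = omega / B Z] it becomes the equation of [B] with
    [e = 2 * omega ^ 2]. Since [B] is
    continuously differentiable, [s] is of class C2 even where it crosses 0,
    although the second order equation degenerates there. *)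
Lemma scalar_profile (gamma : R) : exists delta0, 0 < delta0 /\
  forall delta omega, 0 < delta <= delta0 -> 0 < omega <= / 20 ->
  exists s s1 s2 : R -> R,
    (forall x, -1 < s x < 1 /\ Rabs (s1 x) <= 1 /\
      is_derive s x (s1 x) /\ is_derive s1 x (s2 x) /\ continuous s2 x /\
      emission_slope gamma (delta * s x) * s1 x - 2 * omega * (s1 x ^ 2 + s x * s2 x)
        = omega * (1 - s x ^ 2)) /\
    is_lim s m_infty (-1) /\ is_lim s p_infty 1.
Proof.
  destruct (profile_slowness gamma) as [d0 [Hd0 Hsp]].
  exists d0. split; [auto|]. intros d w Hd Hw.
  destruct (Hsp d (2 * w ^ 2) Hd ltac:(nra)) as [B [B' HB]].
  assert (HBd : forall z, is_derive B z (B' z)) by (intros z; apply HB).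
  assert (HBc : forall z, continuous B z).
  { intros z. apply (ex_derive_continuous (V := R_NormedModule)). eexists; apply HBd. }
  assert (HBr : forall z, 9 / 10 <= B z <= 11 / 10) by (intros z; apply HB).
  destruct (autonomous_flow (fun z => w / B z) (w / 2) (2 * w)) as [Z [HZ [Zm Zp]]].
  - lra.
  - intros z. apply (continuous_mult (K := R_AbsRing) (fun _ => w)); [apply continuous_const|].
    apply (continuous_comp B Rinv); auto. apply continuous_Rinv. specialize (HBr z). lra.
  - intros z. specialize (HBr z).
    assert (E : w / B z * B z = w) by (field; lra).
    split; apply (Rmult_le_reg_r (B z)); try lra; rewrite E; nra.
  - assert (Ht : forall x, is_derive (fun x => tanh (Z x)) x
       (w * (1 - tanh (Z x) ^ 2) / B (Z x))).
    { intros x. pose proof (HBr (Z x)). evar_last.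
      - apply (is_derive_comp tanh Z); [apply is_derive_tanh|apply HZ].
      - unfold scal; simpl; unfold mult; simpl. field. lra. }
    assert (Hb : forall x, is_derive (fun x => B (Z x)) x (w / B (Z x) * B' (Z x))).
    { intros x. apply (is_derive_comp B Z); auto. }
    set (s := fun x => tanh (Z x)). set (b := fun x => B (Z x)).
    set (b1 := fun x => w / b x * B' (Z x)).
    set (s1 := fun x => w * (1 - s x ^ 2) / b x).
    set (s2 := fun x => w * (- 2 * s x * s1 x / b x - (1 - s x ^ 2) * b1 x / b x ^ 2)).
    assert (Hbr : forall x, 9 / 10 <= b x <= 11 / 10) by (intros x; apply HBr).
    change (forall x, is_derive s x (s1 x)) in Ht.
    change (forall x, is_derive b x (b1 x)) in Hb.
    assert (Hsc : forall x, continuous s x).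
    { intros x. apply (ex_derive_continuous (V := R_NormedModule)). eexists; apply Ht. }
    assert (Hbc : forall x, continuous b x).
    { intros x. apply (ex_derive_continuous (V := R_NormedModule)). eexists; apply Hb. }
    assert (Hbi : forall x, continuous (fun t => / b t) x).
    { intros x. apply (continuous_comp b Rinv); auto. apply continuous_Rinv.
      specialize (Hbr x). lra. }
    assert (Hs1 : forall x, is_derive s1 x (s2 x)).
    { intros x. specialize (Hbr x). evar_last.
      - apply (is_derive_div (fun x => w * (1 - s x ^ 2)) b); [|apply Hb|lra].
        apply (is_derive_comp (fun t => w * (1 - t ^ 2)) s); [|apply Ht].
        auto_derive; [auto|reflexivity].
      - unfold scal; simpl; unfold mult; simpl. unfold s2. field. lra. }
    assert (Hs1c : forall x, continuous s1 x).
    { intros x. apply (ex_derive_continuous (V := R_NormedModule)). eexists; apply Hs1. }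
    exists s, s1, s2. split; [|split].
    + intros x. pose proof (Hbr x) as Hbx. pose proof (tanh_range (Z x)) as Hsr.
      change (-1 < s x < 1) in Hsr.
      split; [auto|split; [|split; [auto|split; [auto|split]]]].
      * assert (E : s1 x * b x = w * (1 - s x ^ 2)) by (unfold s1; field; lra).
        assert (0 < 1 - s x ^ 2 <= 1) by nra. apply Rabs_le. split; nra.
      * assert (HZc : continuous Z x).
        { apply (ex_derive_continuous (V := R_NormedModule)). eexists; apply HZ. }
        assert (Hb1c : continuous b1 x).
        { unfold b1. apply (continuous_mult (K := R_AbsRing)).
          - apply (continuous_mult (K := R_AbsRing) (fun _ => w)); auto using continuous_const.
          - apply (continuous_comp Z B'); auto. apply HB. }
        unfold s2. apply (continuous_mult (K := R_AbsRing)); [apply continuous_const|].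
        apply (continuous_minus (V := R_NormedModule)).
        -- apply (continuous_mult (K := R_AbsRing)); auto.
           apply (continuous_mult (K := R_AbsRing)); auto.
           apply (continuous_mult (K := R_AbsRing)); auto using continuous_const.
        -- apply (continuous_mult (K := R_AbsRing)).
           ++ apply (continuous_mult (K := R_AbsRing)); auto.
              apply (continuous_comp s (fun t => 1 - t ^ 2)); auto.
              apply (ex_derive_continuous (V := R_NormedModule)). auto_derive. auto.
           ++ apply (continuous_comp b (fun t => / t ^ 2)); auto.
              apply (ex_derive_continuous (V := R_NormedModule)). auto_derive. nra.
      * destruct (HB (Z x)) as [_ [_ [_ E]]]. fold (s x) (b x) in E.
        assert (E1 : s x * B' (Z x) = (b x ^ 2 * (b x - emission_slope gamma (d * s x))
            + 2 * w ^ 2 * (1 - 3 * s x ^ 2) * b x) / (2 * w ^ 2)).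
        { apply (Rmult_eq_reg_l (2 * w ^ 2)); [|nra]. unfold s, b in *.
          rewrite E. field. lra. }
        replace (s x * s2 x) with (w * (- 2 * s x ^ 2 * s1 x / b x
          - (1 - s x ^ 2) * (w / b x) * (s x * B' (Z x)) / b x ^ 2))
          by (unfold s2, b1; field; lra).
        rewrite E1. unfold s1. field. lra.
    + apply (is_lim_comp tanh Z m_infty (-1) m_infty is_lim_tanh_m Zm).
      exists 0. intros y _. discriminate.
    + apply (is_lim_comp tanh Z p_infty 1 p_infty is_lim_tanh_p Zp).
      exists 0. intros y _. discriminate.
Qed.

(** * The radiative flux and traveling waves *)

Lemma is_RInt_gen_antiderivative (Fa Fb : (R -> Prop) -> Prop) {FFa : Filter Fa}
  {FFb : Filter Fb} (F f : R -> R) (la lb : R) :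
  (forall y, is_derive F y (f y)) -> (forall y, continuous f y) ->
  filterlim F Fa (locally la) -> filterlim F Fb (locally lb) ->
  is_RInt_gen f Fa Fb (lb - la).
Proof.
  intros HF Hf Ha Hb.
  assert (E : forall y, Derive F y = f y) by (intros y; apply is_derive_unique, HF).
  apply (is_RInt_gen_ext (Derive F)).
  { apply filter_forall. intros ab y _. apply E. }
  apply is_RInt_gen_Derive; auto; apply filter_forall; intros ab y _.
  - eexists. apply HF.
  - apply (continuous_ext f); auto.
Qed.

Lemma is_lim_dominated (F : R -> R) (C x s : R) (l : Rbar) :
  l = m_infty /\ s = 1 \/ l = p_infty /\ s = -1 ->
  (forall y, Rabs (F y) <= C * exp (s * (y - x))) -> is_lim F l 0.
Proof.
  intros Hl HF.
  assert (HL : is_lim (fun y => C * exp (s * (y - x))) l 0).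
  { replace (Finite 0) with (Rbar_mult C 0) by (simpl; f_equal; ring).
    apply is_lim_scal_l.
    apply (is_lim_comp exp (fun y => s * (y - x)) l 0 m_infty is_lim_exp_m).
    - apply is_lim_spec. intros M.
      destruct Hl as [[-> ->]|[-> ->]]; simpl.
      + exists (M + x). intros y Hy. lra.
      + exists (- M + x). intros y Hy. lra.
    - destruct Hl as [[-> _]|[-> _]]; exists 0; intros y _; discriminate. }
  apply (is_lim_le_le_loc (fun y => - (C * exp (s * (y - x)))) (fun y => C * exp (s * (y - x)))).
  - assert (HH : forall y, - (C * exp (s * (y - x))) <= F y <= C * exp (s * (y - x))).
    { intros y. apply Rabs_le_between, HF. }
    destruct Hl as [[-> _]|[-> _]]; exists 0; intros y _; apply HH.
  - replace (Finite 0) with (Rbar_opp 0) by (simpl; f_equal; ring).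
    apply is_lim_opp, HL.
  - exact HL.
Qed.

(** The system [q' = w - phi], [phi' = - q] provides the explicit primitives
    [exp y * (q + phi)] of [exp y * w] and [exp (- y) * (q - phi)] of
    [exp (- y) * w]; the convolution is evaluated from them on the two sides of
    [x], where boundedness kills the contributions of infinity. *)
Lemma radiative_flux_integral (w q phi : R -> R) (M x c : R) :
  (forall y, continuous w y) ->
  (forall y, Rabs (q y) <= M) -> (forall y, Rabs (phi y) <= M) ->
  (forall y, is_derive q y (w y - phi y)) -> (forall y, is_derive phi y (- q y)) ->
  is_RInt_gen (fun y => exp (- Rabs (x - y)) * sign (x - y) * w (y - c))
    (Rbar_locally m_infty) (Rbar_locally p_infty) (2 * q (x - c)).
Proof.
  intros Hw Hq Hphi Dq Dphi.
  assert (Hqs : forall y, is_derive (fun y => q (y - c)) y (w (y - c) - phi (y - c))).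
  { intros y. evar_last.
    - apply (is_derive_comp q (fun y => y - c)); [apply Dq|]. auto_derive; [auto|reflexivity].
    - unfold scal; simpl; unfold mult; simpl. ring. }
  assert (Hps : forall y, is_derive (fun y => phi (y - c)) y (- q (y - c))).
  { intros y. evar_last.
    - apply (is_derive_comp phi (fun y => y - c)); [apply Dphi|]. auto_derive; [auto|reflexivity].
    - unfold scal; simpl; unfold mult; simpl. ring. }
  assert (Hws : forall y, continuous (fun y => w (y - c)) y).
  { intros y. apply (continuous_comp (fun y => y - c) w); auto.
    apply (continuous_minus (V := R_NormedModule)); [apply continuous_id|apply continuous_const]. }
  assert (Hexp : forall s y, continuous (fun y => exp (s * (y - x))) y).
  { intros s y. apply (ex_derive_continuous (V := R_NormedModule)). auto_derive. auto. }
  assert (Hdexp : forall s y, is_derive (fun y => exp (s * (y - x))) y (s * exp (s * (y - x)))).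
  { intros s y. auto_derive; [auto|]. unfold Rminus. ring. }
  replace (2 * q (x - c)) with (plus (q (x - c) + phi (x - c) - 0) (0 - (phi (x - c) - q (x - c))))
    by (unfold plus; simpl; ring).
  apply (is_RInt_gen_Chasles (V := R_NormedModule) _ x).
  - set (F := fun y => exp (1 * (y - x)) * (q (y - c) + phi (y - c))).
    apply (is_RInt_gen_ext (fun y => exp (1 * (y - x)) * w (y - c))).
    { exists (fun a => a < x) (fun b => b = x); [exists x; auto|reflexivity|].
      intros a b Ha -> y. simpl. rewrite Rmin_left, Rmax_right by lra. intros Hy.
      rewrite sign_eq_1 by lra. rewrite Rabs_pos_eq by lra.
      rewrite Rmult_1_r. do 2 f_equal. ring. }
    apply (is_RInt_gen_antiderivative _ _ F).
    + intros y. evar_last.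
      { apply (is_derive_mult (fun y => exp (1 * (y - x))) (fun y => q (y - c) + phi (y - c)));
          [apply Hdexp| |intros; apply Rmult_comm].
        apply (is_derive_plus (V := R_NormedModule)); [apply Hqs|apply Hps]. }
      unfold plus, mult; simpl. ring.
    + intros y. apply (continuous_mult (K := R_AbsRing)); auto.
    + apply (is_lim_dominated F (2 * M) x 1 m_infty); [auto|]. intros y. unfold F.
      rewrite Rabs_mult, (Rabs_pos_eq (exp _)) by (left; apply exp_pos).
      rewrite Rmult_comm. apply Rmult_le_compat_r; [left; apply exp_pos|].
      eapply Rle_trans; [apply Rabs_triang|]. specialize (Hq (y - c)). specialize (Hphi (y - c)). lra.
    + replace (q (x - c) + phi (x - c)) with (F x).
      2:{ unfold F. rewrite Rminus_diag, Rmult_0_r, exp_0. ring. }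
      intros P HP. apply (locally_singleton _ _ HP).
  - set (F := fun y => exp (-1 * (y - x)) * (phi (y - c) - q (y - c))).
    apply (is_RInt_gen_ext (fun y => - (exp (-1 * (y - x)) * w (y - c)))).
    { exists (fun b => b = x) (fun a => x < a); [reflexivity|exists x; auto|].
      intros b a -> Ha y. simpl. rewrite Rmin_left, Rmax_right by lra. intros Hy.
      rewrite sign_eq_m1 by lra. rewrite Rabs_left by lra.
      replace (- - (x - y)) with (-1 * (y - x)) by ring. ring. }
    apply (is_RInt_gen_antiderivative _ _ F).
    + intros y. evar_last.
      { apply (is_derive_mult (fun y => exp (-1 * (y - x))) (fun y => phi (y - c) - q (y - c)));
          [apply Hdexp| |intros; apply Rmult_comm].
        apply (is_derive_minus (V := R_NormedModule)); [apply Hps|apply Hqs]. }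
      unfold minus, opp, plus, mult; simpl. ring.
    + intros y. apply (continuous_opp (V := R_NormedModule)).
      apply (continuous_mult (K := R_AbsRing)); auto.
    + replace (phi (x - c) - q (x - c)) with (F x).
      2:{ unfold F. rewrite Rminus_diag, Rmult_0_r, exp_0. ring. }
      intros P HP. apply (locally_singleton _ _ HP).
    + apply (is_lim_dominated F (2 * M) x (-1) p_infty); [auto|]. intros y. unfold F.
      rewrite Rabs_mult, (Rabs_pos_eq (exp _)) by (left; apply exp_pos).
      rewrite Rmult_comm. apply Rmult_le_compat_r; [left; apply exp_pos|].
      unfold Rminus at 1.
      eapply Rle_trans; [apply Rabs_triang|]. rewrite Rabs_Ropp.
      specialize (Hq (y - c)). specialize (Hphi (y - c)). lra.
Qed.

(** The traveling wave after one integration: constant fluxes of mass, momentum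
    and energy in the moving frame, the nonlocal flux [q] being replaced by the
    bounded solution of the elliptic system that it satisfies together with
    [phi], the convolution of [theta ^ 4] with [exp (- |x|) / 2]. *)
Record radiating_profile (Rgas gamma : R) (Um Up : state) (sigma : R)
  (rho u e : R -> R) : Prop := {
  rp_C2 : C2 rho /\ C2 u /\ C2 e;
  rp_positive : forall x, 0 < rho x /\ 0 < e x;
  rp_left : filterlim (fun x => (rho x, u x, e x)) (Rbar_locally m_infty) (locally Um);
  rp_right : filterlim (fun x => (rho x, u x, e x)) (Rbar_locally p_infty) (locally Up);
  rp_balance : exists (j p k M : R) (q phi : R -> R), forall x,
    rho x * (u x - sigma) = j /\
    j * u x + pressure gamma (rho x) (e x) = p /\
    j * total_energy (u x) (e x) + pressure gamma (rho x) (e x) * u x + q x = k /\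
    Rabs (q x) <= M /\ Rabs (phi x) <= M /\
    is_derive phi x (- q x) /\ is_derive q x (temperature Rgas gamma (e x) ^ 4 - phi x) }.

Lemma conservation_law_traveling (sigma k : R) (a : R -> R) (F : R -> R -> R) :
  (forall xi, ex_derive a xi) -> (forall t x, F t x = sigma * a (x - sigma * t) + k) ->
  conservation_law (fun t x => a (x - sigma * t)) F.
Proof.
  intros Ha HF t x. destruct (Ha (x - sigma * t)) as [d Hd].
  exists (- sigma * d), (sigma * d). split; [|split; [|ring]].
  - apply (is_derive_comp a (fun s => x - sigma * s)); [exact Hd|].
    auto_derive; [auto|ring].
  - apply (is_derive_ext (fun y => sigma * a (y - sigma * t) + k)); [intros y; auto|].
    evar_last.
    + apply (is_derive_plus (V := R_NormedModule)).
      * apply (is_derive_scal (fun y => a (y - sigma * t))).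
        apply (is_derive_comp a (fun y => y - sigma * t)); [exact Hd|].
        auto_derive; [auto|reflexivity].
      * apply is_derive_const.
    + unfold plus, scal, zero; simpl; unfold mult; simpl. ring.
Qed.

Lemma radiating_profile_solution (Rgas gamma : R) (Um Up : state) (sigma : R)
  (rho u e : R -> R) :
  radiating_profile Rgas gamma Um Up sigma rho u e ->
  radiating_gas_solution Rgas gamma (fun t x => rho (x - sigma * t))
    (fun t x => u (x - sigma * t)) (fun t x => e (x - sigma * t)).
Proof.
  intros [[Hr [Hu He]] Hpos _ _ [j [p [k [M [q [phi HB]]]]]]].
  assert (Dr : forall x, ex_derive rho x) by (intros x; apply Hr).
  assert (Du : forall x, ex_derive u x) by (intros x; apply Hu).
  assert (De : forall x, ex_derive e x) by (intros x; apply He).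
  assert (Hw : forall y, continuous (fun y => temperature Rgas gamma (e y) ^ 4) y).
  { intros y. unfold temperature.
    apply (continuous_comp e (fun v => ((gamma - 1) * v / Rgas) ^ 4)).
    - apply (ex_derive_continuous (V := R_NormedModule)), De.
    - apply (ex_derive_continuous (V := R_NormedModule)). auto_derive. auto. }
  assert (HI : forall t x, is_RInt_gen
    (flux_integrand (fun t x => temperature Rgas gamma (e (x - sigma * t))) t x)
    (Rbar_locally m_infty) (Rbar_locally p_infty) (2 * q (x - sigma * t))).
  { intros t x. apply (radiative_flux_integral (fun y => temperature Rgas gamma (e y) ^ 4)
      q phi M x (sigma * t)); auto; intros y; apply HB. }
  assert (Hq : forall t x, radiative_flux
    (fun t x => temperature Rgas gamma (e (x - sigma * t))) t x = q (x - sigma * t)).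
  { intros t x. unfold radiative_flux.
    rewrite (is_RInt_gen_unique (V := R_CompleteNormedModule) _ _ (HI t x)). field. }
  unfold radiating_gas_solution. split; [|split; [|split; [|split]]].
  - intros t x. apply Hpos.
  - intros t x. eexists. apply HI.
  - apply (conservation_law_traveling sigma j rho); auto. intros t x.
    destruct (HB (x - sigma * t)) as [H1 _]. lra.
  - apply (conservation_law_traveling sigma p (fun x => rho x * u x)).
    + intros xi. apply (ex_derive_mult rho u); auto.
    + intros t x. destruct (HB (x - sigma * t)) as [H1 [H2 _]]. rewrite <- H2, <- H1. ring.
  - apply (conservation_law_traveling sigma k (fun x => rho x * total_energy (u x) (e x))).
    + intros xi. unfold total_energy. specialize (Dr xi). specialize (Du xi). specialize (De xi).
      auto_derive. auto.
    + intros t x. rewrite Hq. destruct (HB (x - sigma * t)) as [H1 [_ [H3 _]]].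
      rewrite <- H3, <- H1. ring.
Qed.

(** * Regularity and end states *)

Lemma C2_intro (f f1 f2 : R -> R) :
  (forall x, is_derive f x (f1 x) /\ is_derive f1 x (f2 x) /\ continuous f2 x) -> C2 f.
Proof.
  intros H.
  assert (E1 : forall x, f1 x = Derive f x).
  { intros x. symmetry. apply is_derive_unique. exact (proj1 (H x)). }
  assert (E2 : forall x, is_derive (Derive f) x (f2 x)).
  { intros x. apply (is_derive_ext f1); [exact E1|]. exact (proj1 (proj2 (H x))). }
  intros x. split; [|split].
  - exists (f1 x). exact (proj1 (H x)).
  - exists (f2 x). exact (E2 x).
  - apply (continuous_ext f2); [|exact (proj2 (proj2 (H x)))].
    intros t. symmetry. apply is_derive_unique, E2.
Qed.

Lemma C2_comp (F F1 F2 s s1 s2 : R -> R) :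
  (forall x, is_derive s x (s1 x) /\ is_derive s1 x (s2 x) /\ continuous s2 x) ->
  (forall x, is_derive F (s x) (F1 (s x)) /\ is_derive F1 (s x) (F2 (s x)) /\
             continuous F2 (s x)) ->
  C2 (fun x => F (s x)).
Proof.
  intros Hs HF.
  apply (C2_intro _ (fun x => s1 x * F1 (s x))
    (fun x => s2 x * F1 (s x) + s1 x * (s1 x * F2 (s x)))).
  intros x. destruct (Hs x) as [H1 [H2 H3]]. destruct (HF x) as [G1 [G2 G3]].
  assert (D1 : is_derive (fun x => F1 (s x)) x (s1 x * F2 (s x))).
  { apply (is_derive_comp F1 s); auto. }
  assert (Hc1 : continuous s1 x).
  { apply (ex_derive_continuous (V := R_NormedModule)). eexists; exact H2. }
  assert (Hc : continuous s x).
  { apply (ex_derive_continuous (V := R_NormedModule)). eexists; exact H1. }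
  split; [|split].
  - apply (is_derive_comp F s); auto.
  - apply (is_derive_mult s1 (fun x => F1 (s x))); auto. intros; apply Rmult_comm.
  - apply (continuous_plus (V := R_NormedModule)).
    + apply (continuous_mult (K := R_AbsRing)); auto.
      apply (ex_derive_continuous (V := R_NormedModule)). eexists; exact D1.
    + apply (continuous_mult (K := R_AbsRing)); auto.
      apply (continuous_mult (K := R_AbsRing)); auto.
      apply (continuous_comp s F2); auto.
Qed.

Lemma filterlim_state (F : (R -> Prop) -> Prop) {FF : Filter F} (f g h : R -> R) (a b c : R) :
  filterlim f F (locally a) -> filterlim g F (locally b) -> filterlim h F (locally c) ->
  filterlim (fun x => (f x, g x, h x)) F (locally ((a, b, c) : state)).
Proof.
  intros Hf Hg Hh. apply filterlim_locally. intros eps.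
  apply filterlim_locally with (eps := eps) in Hf.
  apply filterlim_locally with (eps := eps) in Hg.
  apply filterlim_locally with (eps := eps) in Hh.
  generalize (filter_and _ _ Hf (filter_and _ _ Hg Hh)). apply filter_imp.
  intros x [H1 [H2 H3]]. split; [split|]; assumption.
Qed.

(** Mass and momentum give [(gamma - 1) * e = v * (C - v)] on both sides. The Lax
    inequalities place [v0] above and [v1] below the sonic velocity
    [gamma * C / (gamma + 1)], hence [v1 < v0]; the energy balance, a quadratic
    equation for [v], then puts the sonic velocity at their midpoint. *)
Lemma shock_energy_law (gamma r0 v0 e0 r1 v1 e1 : R) :
  1 < gamma -> 0 < r0 -> 0 < e0 -> 0 < r1 -> 0 < e1 ->
  r1 * v1 = r0 * v0 ->
  r1 * v1 ^ 2 + (gamma - 1) * r1 * e1 = r0 * v0 ^ 2 + (gamma - 1) * r0 * e0 ->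
  r1 * v1 * (e1 + v1 ^ 2 / 2) + (gamma - 1) * r1 * e1 * v1 =
    r0 * v0 * (e0 + v0 ^ 2 / 2) + (gamma - 1) * r0 * e0 * v0 ->
  sound_speed gamma e0 < v0 -> 0 < v1 < sound_speed gamma e1 ->
  exists C, gamma * C = (gamma + 1) * ((v0 + v1) / 2) /\ v1 < v0 /\
    (gamma - 1) * e0 = v0 * (C - v0) /\ (gamma - 1) * e1 = v1 * (C - v1).
Proof.
  intros Hg Hr0 He0 Hr1 He1 Hm Hp He Hv0 Hv1. unfold sound_speed in *.
  assert (Hs0 : sqrt (gamma * (gamma - 1) * e0) * sqrt (gamma * (gamma - 1) * e0)
    = gamma * (gamma - 1) * e0) by (apply sqrt_sqrt; apply Rmult_le_pos; nra).
  assert (Hs1 : sqrt (gamma * (gamma - 1) * e1) * sqrt (gamma * (gamma - 1) * e1)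
    = gamma * (gamma - 1) * e1) by (apply sqrt_sqrt; apply Rmult_le_pos; nra).
  pose proof (sqrt_pos (gamma * (gamma - 1) * e0)).
  pose proof (sqrt_pos (gamma * (gamma - 1) * e1)).
  set (c0 := sqrt (gamma * (gamma - 1) * e0)) in *.
  set (c1 := sqrt (gamma * (gamma - 1) * e1)) in *.
  assert (S0 : gamma * (gamma - 1) * e0 < v0 * v0) by nra.
  assert (S1 : v1 * v1 < gamma * (gamma - 1) * e1) by nra.
  set (C := v0 + (gamma - 1) * e0 / v0).
  assert (E0 : (gamma - 1) * e0 = v0 * (C - v0)) by (unfold C; field; lra).
  assert (E1 : (gamma - 1) * e1 = v1 * (C - v1)).
  { (* the momentum balance multiplied by v1, the mass flux being factored out *)
    assert (H1 : r0 * v0 * (v1 * v1 + (gamma - 1) * e1 - v1 * C) = 0).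
    { replace (v1 * C) with (v1 * v0 + v1 * ((gamma - 1) * e0) / v0) by (unfold C; field; lra).
      assert (Hp' : r0 * v0 * v1 + (gamma - 1) * r1 * e1 = r0 * v0 * v0 + (gamma - 1) * r0 * e0).
      { replace (r1 * v1 ^ 2) with (r1 * v1 * v1) in Hp by ring. rewrite Hm in Hp.
        replace (r0 * v0 ^ 2) with (r0 * v0 * v0) in Hp by ring. exact Hp. }
      replace (r0 * v0 * (v1 * v1 + (gamma - 1) * e1 - (v1 * v0 + v1 * ((gamma - 1) * e0) / v0)))
        with (v1 * (r0 * v0 * v1 + (gamma - 1) * r1 * e1 - (r0 * v0 * v0 + (gamma - 1) * r0 * e0))
              + (gamma - 1) * e1 * (r0 * v0 - r1 * v1)) by (field; lra).
      rewrite Hp', Hm. ring. }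
    apply Rmult_integral in H1. destruct H1 as [H1|H1]; [nra|lra]. }
  assert (T0 : gamma * C < (gamma + 1) * v0).
  { apply (Rmult_lt_reg_r v0); [lra|]. rewrite Rmult_assoc, E0 in S0. nra. }
  assert (T1 : (gamma + 1) * v1 < gamma * C).
  { apply (Rmult_lt_reg_r v1); [lra|]. rewrite (Rmult_assoc gamma), E1 in S1. nra. }
  assert (Hlt : v1 < v0) by nra.
  assert (HC : gamma * C = (gamma + 1) * ((v0 + v1) / 2)).
  { assert (H1 : r0 * v0 * (gamma * e1 + v1 ^ 2 / 2 - (gamma * e0 + v0 ^ 2 / 2)) = 0).
    { replace (r0 * v0 * (gamma * e1 + v1 ^ 2 / 2 - (gamma * e0 + v0 ^ 2 / 2))) with
        ((r1 * v1 * (e1 + v1 ^ 2 / 2) + (gamma - 1) * r1 * e1 * v1)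
         - (r0 * v0 * (e0 + v0 ^ 2 / 2) + (gamma - 1) * r0 * e0 * v0)
         + (r0 * v0 - r1 * v1) * (gamma * e1 + v1 ^ 2 / 2)) by (field).
      rewrite He, Hm. ring. }
    apply Rmult_integral in H1. destruct H1 as [H1|H1]; [nra|].
    assert (H2 : (v0 - v1) * (2 * gamma * C - (gamma + 1) * (v0 + v1)) = 0).
    { assert (F0 : e0 = v0 * (C - v0) / (gamma - 1)) by (rewrite <- E0; field; lra).
      assert (F1 : e1 = v1 * (C - v1) / (gamma - 1)) by (rewrite <- E1; field; lra).
      rewrite F0, F1 in H1.
      apply (f_equal (fun t => - 2 * (gamma - 1) * t)) in H1. rewrite Rmult_0_r in H1.
      rewrite <- H1. field. lra. }
    apply Rmult_integral in H2. destruct H2 as [H2|H2]; lra. }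
  exists C. auto.
Qed.

(** * From the scalar profile to the gas *)

(** Half the curvature of the energy flux at the sonic velocity, times the square
    of the half-jump [delta * m]: the maximum of [|q|] over the profile, for a mass
    flux [j]. *)
Definition flux_amplitude (gamma j m delta : R) : R :=
  j * (gamma + 1) / (2 * (gamma - 1)) * (delta * m) ^ 2.
(** The value of [theta ^ 4] at the sonic velocity [m]. *)
Definition emission_scale (Rgas gamma m : R) : R := (m ^ 2 / (gamma * Rgas)) ^ 4.

(** The energy balance gives [q = A * (s ^ 2 - 1)], where [A] is the flux
    amplitude, so [q' = theta ^ 4 - phi] defines [phi], and [phi' = - q] becomes
    the scalar equation of the profile divided by the slope of the emission. *)
Lemma radiating_profile_of_scalar (Rgas gamma j m delta omega r0 e0 r1 e1 sigma : R)
  (s s1 s2 : R -> R) :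
  0 < Rgas -> 1 < gamma -> 0 < j -> 0 < m -> 0 < delta < 1 ->
  let v := fun t => m * (1 - delta * t) in
  let epsilon := fun t => m ^ 2 * (1 - delta * t) * (1 + gamma * (delta * t)) / (gamma * (gamma - 1)) in
  r0 * v (-1) = j -> r1 * v 1 = j -> 0 < e0 -> e0 = epsilon (-1) -> e1 = epsilon 1 ->
  flux_amplitude gamma j m delta =
    omega * (4 * emission_scale Rgas gamma m * delta * (gamma - 1)) ->
  (forall x, -1 < s x < 1 /\ Rabs (s1 x) <= 1 /\
      is_derive s x (s1 x) /\ is_derive s1 x (s2 x) /\ continuous s2 x /\
      emission_slope gamma (delta * s x) * s1 x - 2 * omega * (s1 x ^ 2 + s x * s2 x)
        = omega * (1 - s x ^ 2)) ->
  is_lim s m_infty (-1) -> is_lim s p_infty 1 ->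
  exists rho u e, radiating_profile Rgas gamma
    (r0, sigma + v (-1), e0) (r1, sigma + v 1, e1) sigma rho u e.
Proof.
  intros HR Hg Hj Hm Hd v eps Hr0 Hr1 He0p He0 He1 HA Hs Hlm Hlp.
  set (A := flux_amplitude gamma j m delta) in *.
  set (kappa := emission_scale Rgas gamma m) in *.
  assert (Hgd : gamma * delta < 1).
  { apply Rnot_le_lt. intros H. rewrite He0 in He0p. unfold eps in He0p.
    apply (Rmult_lt_compat_r (gamma * (gamma - 1))) in He0p; [|nra].
    rewrite Rmult_0_l in He0p. unfold Rdiv in He0p. rewrite Rmult_assoc, Rinv_l in He0p by nra.
    assert (0 <= m ^ 2 * (1 - delta * -1)) by (apply Rmult_le_pos; nra). nra. }
  assert (Hgt : forall t, -1 <= t <= 1 ->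
    -1 < delta * t < 1 /\ -1 < gamma * (delta * t) < 1).
  { intros t Ht. assert (0 < gamma * delta) by nra. rewrite <- Rmult_assoc. split; split; nra. }
  assert (Hv : forall t, -1 <= t <= 1 -> 0 < v t).
  { intros t Ht. destruct (Hgt t Ht). unfold v. apply Rmult_lt_0_compat; lra. }
  assert (He : forall t, -1 <= t <= 1 -> 0 < eps t).
  { intros t Ht. destruct (Hgt t Ht). unfold eps. apply Rdiv_lt_0_compat; [|nra].
    apply Rmult_lt_0_compat; [apply Rmult_lt_0_compat; [nra|]|]; lra. }
  assert (Hs' : forall x, is_derive s x (s1 x) /\ is_derive s1 x (s2 x) /\ continuous s2 x).
  { intros x. destruct (Hs x) as [_ [_ [H1 [H2 [H3 _]]]]]. auto. }
  assert (Hsr : forall x, -1 <= s x <= 1).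
  { intros x. destruct (Hs x) as [H _]. lra. }
  assert (Dr : forall t, -1 <= t <= 1 -> is_derive (fun t => j / v t) t (j * (m * delta) / v t ^ 2)).
  { intros t Ht. specialize (Hv t Ht). unfold v in *. auto_derive; [lra|]. field. nra. }
  assert (Deps : forall t, is_derive eps t
    (m ^ 2 * delta * (gamma - 1 - 2 * gamma * (delta * t)) / (gamma * (gamma - 1)))).
  { intros t. unfold eps. auto_derive; [auto|]. field. lra. }
  assert (Lim : forall (l : Rbar) (b : R), is_lim s l b -> l = m_infty \/ l = p_infty -> -1 <= b <= 1 ->
    filterlim (fun x => (j / v (s x), sigma + v (s x), eps (s x))) (Rbar_locally l)
      (locally ((j / v b, sigma + v b, eps b) : state))).
  { intros l b Hl Hlb Hb.
    assert (Hl' : filterlim s (Rbar_locally l) (locally b)).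
    { destruct Hlb as [-> | ->]; exact Hl. }
    apply (filterlim_state (Rbar_locally l)).
    - apply (filterlim_comp _ _ _ s (fun t => j / v t) _ (locally b)); auto.
      apply (ex_derive_continuous (V := R_NormedModule) (fun t => j / v t)).
      eexists. apply Dr, Hb.
    - apply (filterlim_comp _ _ _ s (fun t => sigma + v t) _ (locally b)); auto.
      apply (ex_derive_continuous (V := R_NormedModule) (fun t => sigma + v t)).
      unfold v. auto_derive. auto.
    - apply (filterlim_comp _ _ _ s eps _ (locally b)); auto.
      apply (ex_derive_continuous (V := R_NormedModule) eps). eexists. apply Deps. }
  exists (fun x => j / v (s x)), (fun x => sigma + v (s x)), (fun x => eps (s x)). split.
  - split; [|split].
    + apply (C2_comp (fun t => j / v t) (fun t => j * (m * delta) / v t ^ 2)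
        (fun t => 2 * j * (m * delta) ^ 2 / v t ^ 3) s s1 s2); auto.
      intros x. pose proof (Hv _ (Hsr x)) as Hvx. split; [|split].
      * apply Dr, Hsr.
      * unfold v in *. auto_derive; [|field; nra].
        replace (_ * (_ * 1)) with ((m * (1 - delta * s x)) ^ 2) by (simpl; ring). nra.
      * apply (ex_derive_continuous (V := R_NormedModule) (fun t => 2 * j * (m * delta) ^ 2 / v t ^ 3)).
        unfold v in *. auto_derive.
        replace (_ * (_ * (_ * 1))) with ((m * (1 - delta * s x)) ^ 3) by (simpl; ring).
        apply pow_nonzero. lra.
    + apply (C2_comp (fun t => sigma + v t) (fun t => - (m * delta)) (fun _ => 0) s s1 s2); auto.
      intros x. split; [|split].
      * unfold v. auto_derive; [auto|ring].
      * apply (is_derive_const (V := R_NormedModule)).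
      * apply continuous_const.
    + apply (C2_comp eps
        (fun t => m ^ 2 * delta * (gamma - 1 - 2 * gamma * (delta * t)) / (gamma * (gamma - 1)))
        (fun _ => - (2 * m ^ 2 * delta ^ 2 / (gamma - 1))) s s1 s2); auto.
      intros x. split; [apply Deps|split].
      * auto_derive; [auto|]. field. lra.
      * apply continuous_const.
  - intros x. split; [apply Rdiv_lt_0_compat|]; auto.
  - replace r0 with (j / v (-1)).
    + rewrite He0. apply Lim; auto; lra.
    + rewrite <- Hr0. field. specialize (Hv (-1)). lra.
  - replace r1 with (j / v 1).
    + rewrite He1. apply Lim; auto; lra.
    + rewrite <- Hr1. field. specialize (Hv 1). lra.
  - assert (HA0 : 0 <= A).
    { unfold A, flux_amplitude. apply Rmult_le_pos; [|apply pow2_ge_0].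
      apply Rdiv_le_0_compat; nra. }
    assert (Hk0 : 0 <= kappa) by (unfold kappa, emission_scale; apply pow_le, Rdiv_le_0_compat; nra).
    set (X := fun t => (1 - delta * t) * (1 + gamma * (delta * t))).
    assert (HX : forall x, temperature Rgas gamma (eps (s x)) ^ 4 = kappa * X (s x) ^ 4).
    { intros x. unfold temperature, eps, kappa, emission_scale, X. field. lra. }
    (* the momentum flux is constant; the energy flux is evaluated at s = 1 *)
    exists j, (j * (sigma + m * (gamma + 1) / gamma)),
      (j * total_energy (sigma + v 1) (eps 1) + pressure gamma (j / v 1) (eps 1) * (sigma + v 1)),
      (kappa * 4 ^ 4 + 2 * A), (fun x => A * (s x ^ 2 - 1)),
      (fun x => kappa * X (s x) ^ 4 - 2 * A * (s x * s1 x)).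
    intros x. pose proof (Hv _ (Hsr x)) as Hvx. pose proof (Hv 1 ltac:(lra)) as Hv1.
    destruct (Hs x) as [Hx [Hx1 [D1 [D2 [_ E]]]]]. destruct (Hgt _ (Hsr x)) as [G1 G2].
    split; [|split; [|split; [|split; [|split; [|split]]]]].
    + field. lra.
    + unfold pressure, eps. unfold v in *. field. repeat split; lra.
    + unfold A, flux_amplitude, pressure, total_energy, eps. unfold v in *. field. repeat split; lra.
    + rewrite Rabs_mult, (Rabs_pos_eq A) by lra.
      assert (Rabs (s x ^ 2 - 1) <= 1) by (apply Rabs_le; nra).
      pose proof (Rabs_pos (s x ^ 2 - 1)). nra.
    + assert (HX4 : 0 <= X (s x) ^ 4 <= 4 ^ 4).
      { assert (0 <= X (s x) <= 4) by (unfold X; split; nra).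
        split; [apply pow_le|apply pow_incr]; lra. }
      eapply Rle_trans; [apply Rabs_triang|].
      rewrite Rabs_Ropp, !Rabs_mult, (Rabs_pos_eq A), (Rabs_pos_eq 2), (Rabs_pos_eq kappa),
        (Rabs_pos_eq (X (s x) ^ 4)) by lra.
      assert (Rabs (s x) * Rabs (s1 x) <= 1 * 1).
      { apply Rmult_le_compat; auto using Rabs_pos. apply Rabs_le. lra. }
      assert (kappa * X (s x) ^ 4 <= kappa * 4 ^ 4) by (apply Rmult_le_compat_l; lra).
      assert (A * (Rabs (s x) * Rabs (s1 x)) <= A * (1 * 1)) by (apply Rmult_le_compat_l; lra).
      lra.
    + evar_last.
      { apply (is_derive_minus (V := R_NormedModule)).
        - apply (is_derive_comp (fun t => kappa * X t ^ 4) s); [|exact D1].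
          unfold X. auto_derive; [auto|reflexivity].
        - apply (is_derive_scal (fun x => s x * s1 x)).
          apply (is_derive_mult s s1); eauto. intros; apply Rmult_comm. }
      unfold minus, opp, plus, scal, mult; simpl; unfold mult; simpl.
      replace (- (A * (s x * (s x * 1) - 1))) with (A * (1 - s x ^ 2)) by ring.
      rewrite HA.
      replace (omega * _ * (1 - s x ^ 2)) with
        ((4 * kappa * delta * (gamma - 1)) * (omega * (1 - s x ^ 2))) by ring.
      rewrite <- E. unfold emission_slope. field. lra.
    + evar_last.
      { apply (is_derive_comp (fun t => A * (t ^ 2 - 1)) s); [|exact D1].
        auto_derive; [auto|reflexivity]. }
      rewrite HX. unfold scal; simpl; unfold mult; simpl. ring.
Qed.

(** The two small parameters are the relative amplitude [delta] and the ratio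
    [omega] of the flux amplitude to the slope of the emission. Both are at most a
    constant times the velocity jump, uniformly over left states of bounded
    density and sound speed bounded below: the mean velocity [m] is at least half
    of the sound speed, and [omega] is proportional to
    [density * v * delta / m ^ 6]. *)
Lemma weak_lax_1_shock_profile (Rgas gamma rmax cmin : R) :
  0 < Rgas -> 1 < gamma -> 0 < rmax -> 0 < cmin ->
  exists d, 0 < d /\ forall (Um Up : state) (sigma : R),
    admissible Um -> admissible Up ->
    rankine_hugoniot gamma Um Up sigma -> lax_1_shock gamma Um Up sigma ->
    density Um <= rmax -> cmin <= sound_speed gamma (energy Um) ->
    velocity Um - velocity Up <= d ->
    exists rho u e, radiating_profile Rgas gamma Um Up sigma rho u e.
Proof.
  intros HR Hg Hrm Hcm.
  destruct (scalar_profile gamma) as [d0 [Hd0 Hprof]].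
  set (k0 := (gamma + 1) * (gamma * Rgas) ^ 4 / (8 * (gamma - 1) ^ 2)).
  assert (Hk0 : 0 < k0).
  { unfold k0. apply Rdiv_lt_0_compat; [|nra]. apply Rmult_lt_0_compat; [lra|].
    apply pow_lt. nra. }
  set (K := k0 * (2 * rmax / (cmin / 2) ^ 5)).
  assert (Hc5 : 0 < (cmin / 2) ^ 5) by (apply pow_lt; lra).
  assert (HK : 0 < K).
  { unfold K. apply Rmult_lt_0_compat; [auto|]. apply Rdiv_lt_0_compat; lra. }
  set (dmax := Rmin (Rmin d0 (1 / 2)) (/ (20 * K))).
  assert (HiK : 0 < / (20 * K)) by (apply Rinv_0_lt_compat; lra).
  assert (Hdm : 0 < dmax) by (unfold dmax; repeat apply Rmin_glb_lt; lra).
  exists (cmin * dmax). split; [nra|].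
  intros [[r0 u0] e0] [[r1 u1] e1] sigma [Hr0 He0] [Hr1 He1] [Hm [Hp He]] [[L1 L2] L3] Hr Hc Hdu.
  unfold density, velocity, energy, pressure in *. cbn [fst snd] in *.
  set (v0 := u0 - sigma) in *. set (v1 := u1 - sigma) in *.
  destruct (shock_energy_law gamma r0 v0 e0 r1 v1 e1) as [C [HC [Hlt [E0 E1]]]]; auto;
    try (unfold v0; lra); try (unfold v1; lra).
  assert (Hv0 : cmin < v0) by (unfold v0; lra).
  assert (Hv1 : 0 < v1) by (unfold v1; lra).
  set (m := (v0 + v1) / 2) in *. set (delta := (v0 - v1) / (v0 + v1)).
  assert (Hmm : cmin / 2 < m) by (unfold m; lra).
  assert (Em0 : m * (1 - delta * -1) = v0) by (unfold m, delta; field; lra).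
  assert (Em1 : m * (1 - delta * 1) = v1) by (unfold m, delta; field; lra).
  assert (EC : C = (gamma + 1) * m / gamma) by (rewrite <- HC; field; lra).
  assert (Hdel : 0 < delta <= dmax).
  { split; [unfold delta; apply Rdiv_lt_0_compat; lra|].
    apply (Rmult_le_reg_r (v0 + v1)); [lra|]. unfold delta.
    replace ((v0 - v1) / (v0 + v1) * (v0 + v1)) with (u0 - u1) by (unfold v0, v1 in *; field; lra).
    apply Rle_trans with (cmin * dmax); [auto|]. rewrite Rmult_comm.
    apply Rmult_le_compat_l; lra. }
  pose proof (Rmin_l (Rmin d0 (1 / 2)) (/ (20 * K))) as M1.
  pose proof (Rmin_r (Rmin d0 (1 / 2)) (/ (20 * K))) as M2.
  pose proof (Rmin_l d0 (1 / 2)) as M3. pose proof (Rmin_r d0 (1 / 2)) as M4.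
  fold dmax in M1, M2.
  set (j := r0 * v0).
  assert (Hj : 0 < j) by (apply Rmult_lt_0_compat; lra).
  set (omega := k0 * (j / m ^ 6) * delta).
  assert (Hm5 : (cmin / 2) ^ 5 <= m ^ 5) by (apply pow_incr; lra).
  assert (Hm6 : 0 < m ^ 6) by (apply pow_lt; lra).
  assert (Hjm : 0 < j / m ^ 6 <= 2 * rmax / (cmin / 2) ^ 5).
  { split; [apply Rdiv_lt_0_compat; auto|].
    apply Rle_trans with (2 * rmax / m ^ 5).
    - replace (2 * rmax / m ^ 5) with (rmax * (2 * m) / m ^ 6) by (field; lra).
      apply Rmult_le_compat_r; [left; apply Rinv_0_lt_compat, Hm6|].
      apply Rmult_le_compat; lra.
    - apply Rmult_le_compat_l; [lra|]. apply Rinv_le_contravar; lra. }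
  assert (Hom : 0 < omega <= / 20).
  { split; [unfold omega; apply Rmult_lt_0_compat; [apply Rmult_lt_0_compat|]; lra|].
    apply Rle_trans with (K * delta).
    - apply Rmult_le_compat_r; [lra|]. apply Rmult_le_compat_l; lra.
    - apply Rle_trans with (K * / (20 * K)); [apply Rmult_le_compat_l; lra|].
      apply Req_le. field. lra. }
  destruct (Hprof delta omega) as [s [s1 [s2 [Hs [Hlm Hlp]]]]]; [lra|auto|].
  assert (Eu0 : u0 = sigma + m * (1 - delta * -1)) by (rewrite Em0; unfold v0; ring).
  assert (Eu1 : u1 = sigma + m * (1 - delta * 1)) by (rewrite Em1; unfold v1; ring).
  rewrite Eu0, Eu1.
  apply (radiating_profile_of_scalar Rgas gamma j m delta omega r0 e0 r1 e1 sigma s s1 s2);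
    auto; try lra.
  - rewrite Em0. reflexivity.
  - rewrite Em1. exact Hm.
  - apply (Rmult_eq_reg_l (gamma - 1)); [|lra]. rewrite E0, EC, <- Em0. field. lra.
  - apply (Rmult_eq_reg_l (gamma - 1)); [|lra]. rewrite E1, EC, <- Em1. field. lra.
  - unfold omega, k0, flux_amplitude, emission_scale. field. lra.
Qed.

(** The reflection [x -> - x] exchanges the two sides and turns 3-shocks into
    1-shocks. *)
Definition reflect (U : state) : state := (density U, - velocity U, energy U).

Lemma rankine_hugoniot_reflect (gamma : R) (Um Up : state) (sigma : R) :
  rankine_hugoniot gamma Um Up sigma ->
  rankine_hugoniot gamma (reflect Up) (reflect Um) (- sigma).
Proof.
  destruct Um as [[r0 u0] e0]. destruct Up as [[r1 u1] e1].
  unfold rankine_hugoniot, reflect, density, velocity, energy, pressure. simpl.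
  intros [H1 [H2 H3]]. split; [|split]; lra.
Qed.

Lemma C2_reflect (f : R -> R) : C2 f -> C2 (fun x => f (- x)).
Proof.
  intros Hf.
  apply (C2_comp f (Derive f) (Derive (Derive f)) Ropp (fun _ => -1) (fun _ => 0)).
  - intros x. split; [|split].
    + auto_derive; [auto|reflexivity].
    + apply (is_derive_const (V := R_NormedModule)).
    + apply continuous_const.
  - intros x. destruct (Hf (- x)) as [H1 [H2 H3]].
    split; [|split]; auto; apply Derive_correct; auto.
Qed.

Lemma filterlim_reflect (rho u e : R -> R) (l : Rbar) (U : state) :
  l = m_infty \/ l = p_infty ->
  filterlim (fun x => (rho x, u x, e x)) (Rbar_locally (Rbar_opp l)) (locally (reflect U)) ->
  filterlim (fun x => (rho (- x), - u (- x), e (- x))) (Rbar_locally l) (locally U).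
Proof.
  intros Hl H. destruct U as [[r0 u0] e0].
  assert (Ho : filterlim Ropp (Rbar_locally l) (Rbar_locally (Rbar_opp l))).
  { destruct Hl as [-> | ->].
    - apply (is_lim_opp (fun x => x) m_infty m_infty), is_lim_id.
    - apply (is_lim_opp (fun x => x) p_infty p_infty), is_lim_id. }
  pose proof (filterlim_comp _ _ _ _ _ _ _ _ Ho H) as HH. cbv beta in HH.
  apply filterlim_locally. intros eps.
  apply filterlim_locally with (eps := eps) in HH.
  revert HH. apply filter_imp. intros x [[H1 H2] H3]. split; [split|]; auto.
  change (Rabs (u (- x) - - u0) < eps) in H2. change (Rabs (- u (- x) - u0) < eps).
  rewrite <- Rabs_Ropp. replace (- (- u (- x) - u0)) with (u (- x) - - u0) by ring. exact H2.
Qed.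

Lemma radiating_profile_reflect (Rgas gamma : R) (Um Up : state) (sigma : R)
  (rho u e : R -> R) :
  radiating_profile Rgas gamma (reflect Up) (reflect Um) (- sigma) rho u e ->
  radiating_profile Rgas gamma Um Up sigma
    (fun x => rho (- x)) (fun x => - u (- x)) (fun x => e (- x)).
Proof.
  intros [[Cr [Cu Ce]] Hpos Hl Hr [j [p [k [M [q [phi HB]]]]]]]. split.
  - split; [|split].
    + apply C2_reflect, Cr.
    + apply (C2_comp Ropp (fun _ => -1) (fun _ => 0) (fun x => u (- x))
        (Derive (fun x => u (- x))) (Derive (Derive (fun x => u (- x))))).
      * intros x. destruct (C2_reflect u Cu x) as [H1 [H2 H3]].
        split; [|split]; auto; apply Derive_correct; auto.
      * intros x. split; [|split].
        -- auto_derive; [auto|reflexivity].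
        -- apply (is_derive_const (V := R_NormedModule)).
        -- apply continuous_const.
    + apply C2_reflect, Ce.
  - intros x. apply Hpos.
  - apply filterlim_reflect; auto.
  - apply filterlim_reflect; auto.
  - exists (- j), p, (- k), M, (fun x => - q (- x)), (fun x => phi (- x)). intros x.
    destruct (HB (- x)) as [H1 [H2 [H3 [H4 [H5 [H6 H7]]]]]].
    split; [|split; [|split; [|split; [|split; [|split]]]]]; auto.
    + rewrite <- H1. ring.
    + rewrite <- H2. ring.
    + rewrite <- H3. unfold total_energy. field.
    + rewrite Rabs_Ropp. exact H4.
    + evar_last.
      * apply (is_derive_comp phi Ropp); [exact H6|]. auto_derive; [auto|reflexivity].
      * unfold scal; simpl; unfold mult; simpl. ring.
    + evar_last.
      * apply (is_derive_opp (V := R_NormedModule) (fun x => q (- x))).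
        apply (is_derive_comp q Ropp); [exact H7|]. auto_derive; [auto|reflexivity].
      * unfold scal, opp; simpl; unfold mult; simpl. ring.
Qed.

Lemma norm_state_components (U V : state) :
  Rabs (density U - density V) <= norm (minus U V) /\
  Rabs (velocity U - velocity V) <= norm (minus U V) /\
  Rabs (energy U - energy V) <= norm (minus U V).
Proof.
  destruct U as [[r0 u0] e0]. destruct V as [[r1 u1] e1].
  unfold density, velocity, energy; simpl fst; simpl snd.
  change (norm (minus (r0, u0, e0) (r1, u1, e1))) with
    (sqrt (sqrt (Rabs (r0 - r1) ^ 2 + Rabs (u0 - u1) ^ 2) ^ 2 + Rabs (e0 - e1) ^ 2)).
  assert (HH : forall a b, 0 <= a -> 0 <= b -> a <= sqrt (a ^ 2 + b ^ 2) /\ b <= sqrt (a ^ 2 + b ^ 2)).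
  { intros a b Ha Hb. split.
    - rewrite <- (sqrt_pow2 a) at 1 by auto. apply sqrt_le_1_alt. nra.
    - rewrite <- (sqrt_pow2 b) at 1 by auto. apply sqrt_le_1_alt. nra. }
  pose proof (HH _ _ (Rabs_pos (r0 - r1)) (Rabs_pos (u0 - u1))) as [A1 A2].
  pose proof (HH _ _ (sqrt_pos (Rabs (r0 - r1) ^ 2 + Rabs (u0 - u1) ^ 2)) (Rabs_pos (e0 - e1)))
    as [A3 A4].
  lra.
Qed.

Theorem theorem1 (Rgas gamma : R) (hRgas : 0 < Rgas)
  (hgamma : 1 < gamma < (sqrt 7 + 1) / (sqrt 7 - 1))
  (Um : state) (hUm : admissible Um) :
  exists delta : R, 0 < delta /\
    forall (Up : state) (sigma : R),
      admissible Up ->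
      norm (minus Up Um) <= delta ->
      euler_shock gamma Um Up sigma ->
      exists rho u e : R -> R,
        C2 rho /\ C2 u /\ C2 e /\
        radiating_gas_solution Rgas gamma
          (fun t x => rho (x - sigma * t))
          (fun t x => u (x - sigma * t))
          (fun t x => e (x - sigma * t)) /\
        filterlim (fun xi => (rho xi, u xi, e xi)) (Rbar_locally m_infty) (locally Um) /\
        filterlim (fun xi => (rho xi, u xi, e xi)) (Rbar_locally p_infty) (locally Up).
Proof.
  destruct hgamma as [Hg _]. destruct hUm as [Hr He].
  set (c := sound_speed gamma (energy Um)).
  assert (Hc : 0 < c).
  { apply sqrt_lt_R0. apply Rmult_lt_0_compat; [nra|auto]. }
  destruct (weak_lax_1_shock_profile Rgas gamma (2 * density Um) (c / 2)) as [d [Hd Hweak]]; try lra.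
  set (delta := Rmin d (Rmin (density Um) (energy Um / 2))).
  assert (Hdelta : 0 < delta) by (unfold delta; repeat apply Rmin_glb_lt; lra).
  assert (Hle : delta <= d /\ delta <= density Um /\ delta <= energy Um / 2).
  { pose proof (Rmin_l d (Rmin (density Um) (energy Um / 2))).
    pose proof (Rmin_r d (Rmin (density Um) (energy Um / 2))).
    pose proof (Rmin_l (density Um) (energy Um / 2)).
    pose proof (Rmin_r (density Um) (energy Um / 2)). unfold delta. lra. }
  exists delta. split; [auto|]. intros Up sigma HUp Hn [HRH Hlax].
  destruct (norm_state_components Up Um) as [N1 [N2 N3]].
  apply Rabs_le_between in N1. apply Rabs_le_between in N2. apply Rabs_le_between in N3.
  assert (Hprof : exists rho u e, radiating_profile Rgas gamma Um Up sigma rho u e).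
  { destruct Hlax as [Hlax|Hlax].
    - apply Hweak; auto; try split; auto; unfold c in *; lra.
    - destruct HUp as [HrU HeU].
      destruct (Hweak (reflect Up) (reflect Um) (- sigma)) as [rho [u [e Hrp]]].
      + split; [exact HrU|exact HeU].
      + split; [exact Hr|exact He].
      + apply rankine_hugoniot_reflect, HRH.
      + unfold lax_1_shock, lax_3_shock in *. destruct Up as [[r1 u1] e1]. destruct Um as [[r0 u0] e0].
        unfold reflect, density, velocity, energy in *. cbn [fst snd] in *. lra.
      + change (density Up <= 2 * density Um). lra.
      + change (c / 2 <= sound_speed gamma (energy Up)).
        (* e_+ >= e_- / 4, and the sound speed is proportional to the square root of e *)
        rewrite <- (sqrt_pow2 (c / 2)) by lra. apply sqrt_le_1_alt.
        replace ((c / 2) ^ 2) with (c ^ 2 / 4) by field. unfold c, sound_speed.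
        rewrite pow2_sqrt by (apply Rmult_le_pos; nra).
        assert (0 < gamma * (gamma - 1)) by nra. nra.
      + change (- velocity Up - - velocity Um <= d). lra.
      + eexists _, _, _. apply radiating_profile_reflect, Hrp. }
  destruct Hprof as [rho [u [e Hrp]]]. exists rho, u, e.
  destruct (rp_C2 _ _ _ _ _ _ _ _ Hrp) as [C1 [C2' C3]].
  split; [auto|split; [auto|split; [auto|split; [|split]]]].
  - apply (radiating_profile_solution _ _ _ _ _ _ _ _ Hrp).
  - apply (rp_left _ _ _ _ _ _ _ _ Hrp).
  - apply (rp_right _ _ _ _ _ _ _ _ Hrp).
Qed.
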